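(* Let $X$ be a compact Hausdorff space with $X=X_1\cup X_2$, where each of the subspaces $X_1$ and $X_2$ has a $\sigma$-strongly point-finite (respectively, $\sigma$-boundedly point-finite) base. Then $\mathrm{cl}_X(X_1)\cap \mathrm{cl}_X(X_2)$ is metrizable and $X$ is an Eberlein compact (respectively, a uniform Eberlein compact).
   Context: An Eberlein compact is a compact Hausdorff space homeomorphic to a weakly compact subset of a Banach space; a uniform Eberlein compact is a compact Hausdorff space homeomorphic to a weakly compact subset of a Hilbert space. A family $\mathcal{U}$ of subsets of a set is strongly point-finite if every countably infinite subfamily of $\mathcal{U}$ contains a finite subfamily with empty intersection. The order $ord(\mathcal{U})$ is the largest integer $n$ such that $\mathcal{U}$ contains $n+1$ members with non-empty intersection (or $\infty$ if none exists); $\mathcal{U}$ is boundedly point-finite if its order is finite. A family is $\sigma$-strongly point-finite (resp. $\sigma$-boundedly point-finite) if it is a union of countably many strongly point-finite (resp. boundedly point-finite) families. *)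

(* Defs.v *)
From mathcomp Require Import all_boot all_order all_algebra.
From mathcomp Require Import all_classical all_reals all_analysis.
Set Implicit Arguments. Unset Strict Implicit. Unset Printing Implicit Defensive.
Import Order.TTheory GRing.Theory Num.Theory.
Import numFieldNormedType.Exports.
Local Open Scope classical_set_scope.
Local Open Scope ring_scope.

Section Families.
Context {X : topologicalType}.

(* a family [U] of subsets of the subspace [S] (an "ambient" subset of X);
   intersections are taken inside the subspace S *)
Definition strongly_point_finite (S : set X) (U : set (set X)) : Prop :=
  forall F : set (set X), F `<=` U -> countable F -> ~ finite_set F ->
    exists G : set (set X), [/\ G `<=` F, finite_set G &
      S `&` \bigcap_(A in G) A = set0].

Definition boundedly_point_finite (S : set X) (U : set (set X)) : Prop :=
  exists n : nat, forall f : nat -> set X,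
    (forall i, (i <= n)%N -> U (f i)) ->
    (forall i j, (i <= n)%N -> (j <= n)%N -> f i = f j -> i = j) ->
    S `&` \bigcap_(i in [set i | (i <= n)%N]) f i = set0.

Definition is_subspace_base (S : set X) (B : set (set X)) : Prop :=
  (forall A, B A -> exists V : set X, open V /\ A = V `&` S) /\
  (forall x (V : set X), S x -> open V -> V x ->
     exists A, [/\ B A, A x & A `<=` V]).

Definition sigma_strongly_point_finite_base (S : set X) : Prop :=
  exists B : nat -> set (set X),
    (forall n, strongly_point_finite S (B n)) /\
    is_subspace_base S (\bigcup_n B n).

Definition sigma_boundedly_point_finite_base (S : set X) : Prop :=
  exists B : nat -> set (set X),
    (forall n, boundedly_point_finite S (B n)) /\
    is_subspace_base S (\bigcup_n B n).

Definition metrizable_subspace (R : realType) (S : set X) : Prop :=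
  exists d : X -> X -> R,
    [/\ (forall x y, S x -> S y -> (d x y = 0 <-> x = y)),
        (forall x y, S x -> S y -> d x y = d y x),
        (forall x y z, S x -> S y -> S z -> d x z <= d x y + d y z) &
        (forall A : set X, A `<=` S ->
           ((exists V : set X, open V /\ A = V `&` S) <->
            (forall x, A x -> exists2 e : R, 0 < e &
               [set y | S y /\ d x y < e] `<=` A)))].
End Families.

Section Weak.
Context {R : realType} {V : normedModType R}.

Definition continuous_linear_functional (f : V -> R) : Prop :=
  [/\ (forall x y, f (x + y) = f x + f y),
      (forall (a : R) x, f (a *: x) = a * f x) & continuous f].

Definition weak_open (U : set V) : Prop :=
  forall x, U x -> exists (n : nat) (fs : nat -> V -> R) (e : R),
    [/\ 0 < e, (forall i, (i < n)%N -> continuous_linear_functional (fs i)) &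
        [set y | forall i, (i < n)%N -> `|fs i y - fs i x| < e] `<=` U].

Definition weakly_compact (K : set V) : Prop :=
  forall C : set (set V), (forall W, C W -> weak_open W) ->
    K `<=` \bigcup_(W in C) W ->
    exists2 D : set (set V), D `<=` C /\ finite_set D & K `<=` \bigcup_(W in D) W.

Definition weakly_compact_embeds (X : topologicalType) : Prop :=
  exists (h : X -> V) (K : set V),
    [/\ weakly_compact K, h @` setT = K, injective h,
        (forall W, weak_open W -> open (h @^-1` W)) &
        (forall U : set X, open U ->
           exists2 W, weak_open W & h @` U = W `&` K)].
End Weak.

Definition inner_product (R : realType) (V : normedModType R)
    (ip : V -> V -> R) : Prop :=
  [/\ (forall x y z, ip (x + y) z = ip x z + ip y z),
      (forall (a : R) x y, ip (a *: x) y = a * ip x y),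
      (forall x y, ip x y = ip y x) &
      (forall x, ip x x = `|x| ^+ 2)].

Definition eberlein_compact (R : realType) (X : topologicalType) : Prop :=
  exists V : completeNormedModType R, @weakly_compact_embeds R V X.

Definition uniform_eberlein_compact (R : realType) (X : topologicalType) : Prop :=
  exists (V : completeNormedModType R) (ip : V -> V -> R),
    inner_product ip /\ @weakly_compact_embeds R V X.

(* Main.v *)
Require Import Defs.
From HB Require Import structures.
From mathcomp Require Import all_boot all_order all_algebra.
From mathcomp Require Import all_classical all_reals all_analysis.
From mathcomp Require Import ring lra finmap.
Set Implicit Arguments. Unset Strict Implicit. Unset Printing Implicit Defensive.
Import Order.TTheory GRing.Theory Num.Theory.
Import numFieldNormedType.Exports.
Local Open Scope classical_set_scope.
Local Open Scope ring_scope.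

(** Replacing each member [A] of a base of [Xi] by the largest open set [E] of [X]
with [E `&` Xi `<=` A] gives a family which is still point-finite at
the points of [closure Xi] (this is where strong point-finiteness is used) and
an outer base there at the points of [Xi]. On the intersection [K] of the two
closures the two families together give a point-countable base, hence a
countable one by Mishchenko's lemma, so [K] is metrizable. The rest of [X] is
the union of two disjoint open sets, one inside each [Xi]. The base members [A]
with closure inside one of them have a second countable closure, again by
Mishchenko, so each is a countable union of cozero sets. The corresponding
functions, together with countably many functions separating [K], form
countably many (boundedly) point-finite families separating the points of
[X]. After scaling they are the coordinates of a weak embedding of [X] into
[c_0] (into [l_2] in the bounded case). *)

(** * The Banach spaces [c_0(T)] and [l_2(T)] *)

Section Gauge.
Variables (b : bool) (R : realType).
Implicit Types x y z r s c : R.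

(* Both spaces are treated at once: [b = false] is the sup norm, [b = true] the
   Euclidean norm. *)
Definition hjoin x y := if b then Num.sqrt (x ^+ 2 + y ^+ 2) else Num.max x y.

Lemma hjoin_ge0 x y : 0 <= x -> 0 <= hjoin x y.
Proof.
rewrite /hjoin; case: b => x0; first exact: sqrtr_ge0.
by rewrite le_max x0.
Qed.

Lemma hjoinC x y : hjoin x y = hjoin y x.
Proof. by rewrite /hjoin; case: b; [rewrite addrC|rewrite maxC]. Qed.

Lemma hjoinA x y z : hjoin x (hjoin y z) = hjoin (hjoin x y) z.
Proof.
rewrite /hjoin; case: b; last by rewrite maxA.
by rewrite !sqr_sqrtr ?addrA// addr_ge0// sqr_ge0.
Qed.

Lemma hjoin0 x : 0 <= x -> hjoin 0 x = x.
Proof.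
move=> x0; rewrite /hjoin; case: b; first by rewrite expr0n add0r sqrtr_sqr ger0_norm.
by rewrite max_r.
Qed.

Lemma hjoin_mono x y r s : 0 <= x -> 0 <= r -> x <= y -> r <= s ->
  hjoin x r <= hjoin y s.
Proof.
move=> x0 r0 xy rs; rewrite /hjoin.
have y0 := le_trans x0 xy; have s0 := le_trans r0 rs.
case: b; first by rewrite ler_sqrt ?lerD ?lerXn2r ?addr_ge0 ?sqr_ge0.
by rewrite ge_max !le_max xy rs orbT.
Qed.

Lemma hjoinM c x y : 0 <= c -> hjoin (c * x) (c * y) = c * hjoin x y.
Proof.
move=> c0; rewrite /hjoin; case: b; last by rewrite maxr_pMr.
by rewrite !exprMn -mulrDr sqrtrM ?sqr_ge0// sqrtr_sqr ger0_norm.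
Qed.

(** Squaring reduces the Euclidean case to Cauchy-Schwarz in the plane, whose defect is the square
    of [x * s - y * r]. *)
Lemma hjoinD x y r s : 0 <= x -> 0 <= y -> 0 <= r -> 0 <= s ->
  hjoin (x + y) (r + s) <= hjoin x r + hjoin y s.
Proof.
move=> x0 y0 r0 s0; rewrite /hjoin; case: b; last first.
  by rewrite ge_max !lerD// le_max lexx ?orbT.
rewrite -(@ler_pXn2r _ 2)// ?nnegrE ?addr_ge0 ?sqrtr_ge0//.
rewrite [leRHS]sqrrD !sqr_sqrtr ?addr_ge0 ?sqr_ge0//.
suff : x * y + r * s <= Num.sqrt (x ^+ 2 + r ^+ 2) * Num.sqrt (y ^+ 2 + s ^+ 2).
  by rewrite mulr2n; lra.
rewrite -sqrtrM ?addr_ge0 ?sqr_ge0//.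
rewrite -[leLHS]ger0_norm; last by rewrite addr_ge0 ?mulr_ge0.
rewrite -sqrtr_sqr ler_sqrt; last first.
  by rewrite mulr_ge0 ?addr_ge0 ?sqr_ge0.
by rewrite -subr_ge0; have := sqr_ge0 (x * s - y * r); congr (0 <= _); ring.
Qed.

Lemma hjoin_sqr x y : 0 <= x -> 0 <= y -> hjoin x y ^+ 2 <= x ^+ 2 + y ^+ 2.
Proof.
move=> x0 y0; rewrite /hjoin; case: b; first by rewrite sqr_sqrtr// addr_ge0// sqr_ge0.
by have [_|_] := leP x y; rewrite ?lerDl ?lerDr sqr_ge0.
Qed.

Lemma hjoin_gel x y : 0 <= x -> 0 <= y -> x <= hjoin x y.
Proof.
by move=> x0 y0; rewrite -{1}(hjoin0 x0) hjoinC hjoin_mono.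
Qed.

Lemma hjoin_leD x y : 0 <= x -> 0 <= y -> hjoin x y <= x + y.
Proof.
move=> x0 y0; have := hjoinD x0 (lexx 0) (lexx 0) y0.
by rewrite addr0 add0r (hjoinC x 0) !hjoin0.
Qed.

End Gauge.

Section FiniteGauge.
Variables (b : bool) (R : realType) (T : choiceType).
Implicit Types (s t : seq T) (f g : T -> R).
Local Notation hjoin := (@hjoin b R).

(** The sup or Euclidean norm of [f] on the list [s], repeated entries being counted with
    multiplicity. *)
Definition fgauge s f : R := foldr (fun i r => hjoin `|f i| r) 0 s.

Lemma fgauge_ge0 s f : 0 <= fgauge s f.
Proof. by elim: s => //= i s IH; rewrite hjoin_ge0. Qed.

Lemma fgaugeD s f g : fgauge s (f \+ g) <= fgauge s f + fgauge s g.
Proof.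
elim: s => [|i s IH] /=; first by rewrite addr0.
apply: (le_trans _ (hjoinD _ _ _ _ _)); rewrite ?fgauge_ge0//.
by rewrite hjoin_mono ?fgauge_ge0 ?ler_normD.
Qed.

Lemma fgaugeZ s c f : fgauge s (fun i => c * f i) = `|c| * fgauge s f.
Proof.
elim: s => [|i s IH] /=; first by rewrite mulr0.
by rewrite IH normrM hjoinM.
Qed.

Lemma fgauge_le_sum s f : fgauge s f <= \sum_(i <- s) `|f i|.
Proof.
elim: s => [|i s IH] /=; first by rewrite big_nil.
by rewrite big_cons (le_trans (hjoin_leD _ _ _))// ?fgauge_ge0// lerD.
Qed.

Lemma fgauge_le_size s f e : (forall i, i \in s -> `|f i| <= e) ->
  fgauge s f <= (size s)%:R * e.
Proof.
move=> fe; apply: (le_trans (fgauge_le_sum _ _)).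
rewrite -sum1_size natr_sum mulr_suml big_seq [leRHS]big_seq.
by apply: ler_sum => i /fe; rewrite mul1r.
Qed.

Lemma fgauge_split (P : pred T) s f :
  fgauge s f = hjoin (fgauge [seq i <- s | P i] f) (fgauge [seq i <- s | ~~ P i] f).
Proof.
elim: s => [|i s IH] /=; first by rewrite hjoin0.
case: (P i) => /=; rewrite IH; first by rewrite hjoinA.
by rewrite hjoinC -hjoinA; congr hjoin; rewrite hjoinC.
Qed.

Lemma fgauge_le_filterD (P : pred T) s f :
  fgauge s f <= fgauge [seq i <- s | P i] f + fgauge [seq i <- s | ~~ P i] f.
Proof. by rewrite (fgauge_split P) hjoin_leD ?fgauge_ge0. Qed.

Lemma fgauge_disjoint (P : pred T) s f g :
  (forall i, ~~ P i -> f i = 0) -> (forall i, P i -> g i = 0) ->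
  fgauge s (f \+ g) = hjoin (fgauge s f) (fgauge s g).
Proof.
move=> f0 g0; elim: s => [|i s IH] /=; first by rewrite hjoin0.
have [Pi|nPi] := boolP (P i).
  by rewrite g0// addr0 normr0 (hjoin0 _ (fgauge_ge0 _ _)) IH hjoinA.
rewrite f0// add0r normr0 (hjoin0 _ (fgauge_ge0 _ _)) IH.
by rewrite hjoinA hjoinC (hjoinC _ _ (fgauge s f)) hjoinC -hjoinA.
Qed.

End FiniteGauge.

Section TailSpace.
Variables (b : bool) (R : realType) (T : choiceType).
Implicit Types (s t G : seq T) (f g : T -> R^o).
Local Notation fgauge := (@fgauge b R T).

(** [G] is the finite exceptional set. Testing all finite lists away from it bounds the norm of the
    tail without forming an infinite sum. *)
Definition small_off G e f : Prop :=
  forall s, uniq s -> (forall i, i \in s -> i \notin G) -> fgauge s f <= e.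

(* The closure of the finitely supported functions. *)
Definition null_tail : {pred T -> R^o} :=
  fun f => `[< forall e, 0 < e -> exists G, small_off G e f >].

Lemma small_off_cat G H d e f g :
  small_off G d f -> small_off H e g -> small_off (G ++ H) (d + e) (f \+ g).
Proof.
move=> Gf Hg s us sGH; apply: (le_trans (fgaugeD _ _ _ _)).
by rewrite lerD ?Gf ?Hg// => i /sGH; rewrite mem_cat negb_or => /andP[].
Qed.

Lemma small_off_scale G e c f :
  small_off G e f -> small_off G (`|c| * e) (fun i => c * f i).
Proof. by move=> Gf s us sG; rewrite fgaugeZ ler_wpM2l ?Gf. Qed.

Lemma null_tail_submod : submod_closed null_tail.
Proof.
split=> [|c f g /asboolP nf /asboolP ng]; apply/asboolP => e e0.
  exists [::] => s us _.
  have -> : (0 : T -> R^o) = (fun i => 0 * 0) by apply/funext => i; rewrite mulr0.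
  by rewrite fgaugeZ normr0 mul0r ltW.
have e2 : 0 < e / 2 by rewrite divr_gt0.
have c0 : 0 < `|c| + 1 by rewrite ltr_wpDl.
have [G Gf] := nf _ (divr_gt0 e2 c0); have [H Hg] := ng _ e2.
exists (G ++ H); have := small_off_cat (small_off_scale c Gf) Hg.
move=> GH s us sGH; apply: (le_trans (GH s us sGH)).
rewrite [leRHS](splitr e) lerD2r mulrCA ger_pMr// ler_pdivrMr// mul1r.
by rewrite lerDl.
Qed.

HB.instance Definition _ :=
  GRing.isSubmodClosed.Build R (T -> R^o) null_tail null_tail_submod.

Record tailspace := TailSpace { tailval : T -> R^o; tailvalP : tailval \in null_tail }.
HB.instance Definition _ := [isSub for tailval].
HB.instance Definition _ := [Choice of tailspace by <:].
HB.instance Definition _ := [SubChoice_isSubLmodule of tailspace by <:].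

(** Off the exceptional list for tolerance 1 the gauge is at most 1, and on that list a crude count
    suffices. This makes the supremum in [tail_norm] finite. *)
Lemma fgauge_bounded f : f \in null_tail ->
  exists M, forall s, uniq s -> fgauge s f <= M.
Proof.
move=> /asboolP/(_ 1 ltr01)[G Gf]; exists ((size G)%:R * (\sum_(i <- G) `|f i|) + 1).
move=> s us; apply: (le_trans (fgauge_le_filterD b (fun i => i \in G) _ _)); apply: lerD.
  apply: (@le_trans _ _ ((size [seq i <- s | i \in G])%:R * (\sum_(i <- G) `|f i|))).
    apply: fgauge_le_size => i; rewrite mem_filter => /andP[iG _].
    by rewrite (big_rem i)//= lerDl sumr_ge0.
  rewrite ler_wpM2r ?sumr_ge0// ler_nat uniq_leq_size ?filter_uniq// => i.
  by rewrite mem_filter => /andP[].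
by apply: Gf; rewrite ?filter_uniq// => i; rewrite mem_filter => /andP[].
Qed.

Definition tail_norm (u : tailspace) : R :=
  sup [set fgauge s (tailval u) | s in [set s | uniq s]].

Lemma fgauge_le_tail_norm s u : uniq s -> fgauge s (tailval u) <= tail_norm u.
Proof.
move=> us; apply: ub_le_sup; last by exists s.
have [M uM] := fgauge_bounded (tailvalP u).
by exists M => _ [t /= ut <-]; exact: uM.
Qed.

Lemma tail_norm_le u M :
  (forall s, uniq s -> fgauge s (tailval u) <= M) -> tail_norm u <= M.
Proof.
move=> uM; apply: ge_sup; last by move=> _ [s /= us <-]; exact: uM.
by exists (fgauge [::] (tailval u)), [::].
Qed.

Lemma tail_norm_ge0 u : 0 <= tail_norm u.
Proof. exact: (@fgauge_le_tail_norm [::]). Qed.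

Lemma tailval_le_norm u i : `|tailval u i| <= tail_norm u.
Proof.
apply: le_trans (fgauge_le_tail_norm u (_ : uniq [:: i])) => //=.
exact: hjoin_gel.
Qed.

Lemma tail_normD u v : tail_norm (u + v) <= tail_norm u + tail_norm v.
Proof.
apply: tail_norm_le => s us; apply: (le_trans (fgaugeD _ _ _ _)).
by rewrite lerD ?fgauge_le_tail_norm.
Qed.

Lemma tail_normZ_le c u : tail_norm (c *: u) <= `|c| * tail_norm u.
Proof.
by apply: tail_norm_le => s us; rewrite fgaugeZ ler_wpM2l ?fgauge_le_tail_norm.
Qed.

Lemma tail_normZ c u : tail_norm (c *: u) = `|c| * tail_norm u.
Proof.
apply/eqP; rewrite eq_le tail_normZ_le/=.
have [->|c0] := eqVneq c 0; first by rewrite normr0 mul0r tail_norm_ge0.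
rewrite -ler_pdivlMl ?normr_gt0//.
by have := tail_normZ_le c^-1 (c *: u); rewrite scalerA mulVf// scale1r normfV.
Qed.

Lemma tailval_inj : injective tailval.
Proof. exact: val_inj. Qed.

Lemma tail_norm0_eq0 u : tail_norm u = 0 -> u = 0.
Proof.
move=> u0; apply: tailval_inj; apply/funext => i; apply/eqP.
by rewrite -normr_le0 -u0 tailval_le_norm.
Qed.

HB.instance Definition _ :=
  Lmodule_isNormed.Build R tailspace tail_normD tail_normZ tail_norm0_eq0.

Lemma tailspace_normE u : `|u| = tail_norm u.
Proof. by []. Qed.

(** The limit [l] is taken coordinatewise. On a finite list, [l] is compared with [v] through some
    [u] of the filter that is close to [v] in norm and to [l] on that list. The resulting bound does
    not depend on the list, so it puts [l] in the space and gives convergence in norm. *)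
Lemma tailspace_complete (F : set_system tailspace) :
  ProperFilter F -> cauchy F -> cvg F.
Proof.
move=> FF cF.
have {}cF e : 0 < e -> exists v, F [set u | `|v - u| < e].
  move=> e0; have /cauchyP/(_ e e0)[v Fv] := cF; exists v.
  by move: Fv; rewrite -ball_normE.
have Fle e v i : F [set u : tailspace | `|v - u| < e] ->
    F [set u : tailspace | `|tailval v i - tailval u i| < e].
  move=> Fv; apply: filterS Fv => u /=; apply: le_lt_trans.
  exact: (tailval_le_norm (v - u)).
pose ev i : set_system R^o := [set A | F [set u : tailspace | A (tailval u i)]].
have evF i : ProperFilter (ev i) by exact: (fmap_proper_filter (fun u => tailval u i) FF).
have /choice[l lP] : forall i, exists l : R^o, ev i --> l.
  move=> i; apply/cvg_ex; apply: (@R_complete R (ev i) (evF i)).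
  apply: cauchy_exP => e e0.
  have [v Fv] := cF e e0; exists (tailval v i : R^o).
  by rewrite -ball_normE; exact: (Fle _ _ i Fv).
have near_l i e : 0 < e -> F [set u | `|l i - tailval u i| < e].
  by move=> e0; have := lP i _ (nbhsx_ballx (l i) e e0); rewrite -ball_normE.
have lv e v : F [set u | `|v - u| < e] ->
    forall s, uniq s -> fgauge s (l \- tailval v) <= e.
  move=> Fv s us; apply/ler_addgt0Pr => d d0.
  pose d' := d / (size s).+1%:R.
  have d'0 : 0 < d' by rewrite divr_gt0.
  have Fs : F [set u | forall i, i \in s -> `|l i - tailval u i| < d'].
    elim: (s) => [|i t IH]; first by apply: filterE.
    apply: filterS (filterI (near_l i d' d'0) IH) => u [/= ui ut] j.
    by rewrite inE => /predU1P[->|/ut].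
  have [u [/= vu us']] := filter_ex (filterI Fv Fs).
  have -> : l \- tailval v = (l \- tailval u) \+ (tailval (u - v)).
    by apply/funext => i /=; rewrite addrA subrK.
  apply: (le_trans (fgaugeD _ _ _ _)); rewrite addrC; apply: lerD.
    by apply: (le_trans (fgauge_le_tail_norm _ us)); rewrite -tailspace_normE distrC ltW.
  apply: (@le_trans _ _ ((size s)%:R * d')).
    by apply: fgauge_le_size => i /us'/ltW.
  rewrite /d' mulrCA ger_pMr// ler_pdivrMr// mul1r ler_nat//.
have ln : l \in null_tail.
  apply/asboolP => e e0; have e2 : 0 < e / 2 by rewrite divr_gt0.
  have [v Fv] := cF _ e2; have /asboolP/(_ _ e2)[G Gv] := tailvalP v.
  exists G => s us sG.
  have -> : l = (l \- tailval v) \+ tailval v by apply/funext => i /=; rewrite subrK.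
  apply: (le_trans (fgaugeD _ _ _ _)); rewrite (splitr e).
  by rewrite lerD ?Gv// lv.
apply/cvg_ex; exists (TailSpace ln); apply/cvgrPdist_le => e e0.
have e2 : 0 < e / 2 by rewrite divr_gt0.
have [v Fv] := cF _ e2; apply: filterS (Fv) => u /= vu.
rewrite (splitr e) -(subrK v (TailSpace ln)) -addrA.
apply: (le_trans (ler_normD _ _)); apply: lerD; last exact: ltW.
by apply: tail_norm_le => s us; exact: (lv _ _ Fv).
Qed.

HB.instance Definition _ := Uniform_isComplete.Build tailspace tailspace_complete.

End TailSpace.

(** * Functionals and weak embeddings *)

Section Truncation.
Variables (b : bool) (R : realType) (T : choiceType).
Implicit Types (u v w : tailspace b R T) (s G : seq T) (P : pred T).
Local Notation fgauge := (@fgauge b R T).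

Definition cutoff P (f : T -> R^o) : T -> R^o := fun i => if P i then f i else 0.

Lemma fgauge_cutoff P s f : fgauge s (cutoff P f) = fgauge [seq i <- s | P i] f.
Proof.
elim: s => //= i s IH; rewrite {1}/cutoff IH; case: (P i) => //=.
by rewrite normr0 hjoin0// fgauge_ge0.
Qed.

Lemma null_tail_cutoff P u : cutoff P (tailval u) \in @null_tail b R T.
Proof.
apply/asboolP => e e0; have /asboolP/(_ e e0)[G uG] := tailvalP u.
exists G => s us sG; rewrite fgauge_cutoff uG ?filter_uniq// => i.
by rewrite mem_filter => /andP[_ /sG].
Qed.

Definition trunc P u := TailSpace (null_tail_cutoff P u).

Lemma truncDC P u : trunc P u + trunc (predC P) u = u.
Proof.
apply: tailval_inj; apply/funext => i.
rewrite -[LHS]/(cutoff P (tailval u) i + cutoff (predC P) (tailval u) i).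
by rewrite /cutoff/=; case: (P i); rewrite ?addr0 ?add0r.
Qed.

Lemma trunc_norm_le P u e :
  (forall s, uniq s -> all P s -> fgauge s (tailval u) <= e) -> `|trunc P u| <= e.
Proof.
move=> ue; apply: tail_norm_le => s us; rewrite fgauge_cutoff.
by rewrite ue ?filter_uniq// filter_all.
Qed.

Lemma trunc_le_norm P u : `|trunc P u| <= `|u|.
Proof. by apply: trunc_norm_le => s us _; exact: fgauge_le_tail_norm. Qed.

Lemma trunc_norm_le_size G u e : 0 <= e -> (forall i, i \in G -> `|tailval u i| <= e) ->
  `|trunc (fun i => i \in G) u| <= (size G)%:R * e.
Proof.
move=> e0 ue; apply: trunc_norm_le => s us /allP sG.
apply: (@le_trans _ _ ((size s)%:R * e)).
  by apply: fgauge_le_size => i /sG; exact: ue.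
by rewrite ler_wpM2r// ler_nat uniq_leq_size.
Qed.

(** Pythagoras in the Euclidean case; for the sup norm, the maximum of two squares is below their
    sum. This common inequality lets one estimate of functionals serve both spaces. *)
Lemma norm_disjoint_sqr P u v :
  (forall i, ~~ P i -> tailval u i = 0) -> (forall i, P i -> tailval v i = 0) ->
  `|u + v| ^+ 2 <= `|u| ^+ 2 + `|v| ^+ 2.
Proof.
move=> uP vP.
have uv0 : 0 <= `|u| ^+ 2 + `|v| ^+ 2 by rewrite addr_ge0 ?sqr_ge0.
rewrite -(sqr_sqrtr uv0) lerXn2r ?nnegrE ?sqrtr_ge0//.
apply: tail_norm_le => s us; rewrite (fgauge_disjoint b s uP vP).
rewrite -[leLHS]ger0_norm ?hjoin_ge0 ?fgauge_ge0// -sqrtr_sqr ler_sqrt//.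
apply: (le_trans (hjoin_sqr _ _ _)); rewrite ?fgauge_ge0//.
by rewrite lerD// lerXn2r ?nnegrE ?fgauge_ge0 ?tail_norm_ge0 ?fgauge_le_tail_norm.
Qed.

End Truncation.

Section Functional.
Variables (R : realType) (V : normedModType R) (phi : V -> R).
Hypothesis phiP : continuous_linear_functional phi.

Lemma functionalD u v : phi (u + v) = phi u + phi v.
Proof. by case: phiP. Qed.

Lemma functionalZ c u : phi (c *: u) = c * phi u.
Proof. by case: phiP. Qed.

Lemma functionalN u : phi (- u) = - phi u.
Proof. by rewrite -scaleN1r functionalZ mulN1r. Qed.

Lemma functional_bounded : exists2 C, 0 < C & forall u, `|phi u| <= C * `|u|.
Proof.
have phi0 : phi 0 = 0 by rewrite -(scale0r 0) functionalZ mul0r.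
have [_ _ /(_ 0)/cvgrPdist_lt/(_ 1 ltr01)] := phiP.
rewrite phi0 => /nbhs_ballP[d /= d0 dP].
exists (2 / d) => [|u]; first by rewrite divr_gt0.
have [->|u0] := eqVneq u 0; first by rewrite phi0 !normr0 mulr0.
have nu : 0 < `|u| by rewrite normr_gt0.
have c0 : 0 < d / 2 / `|u| by rewrite !divr_gt0.
have : `|phi ((d / 2 / `|u|) *: u)| < 1.
  move: (dP ((d / 2 / `|u|) *: u)); rewrite -ball_normE /= !sub0r !normrN.
  apply; rewrite normrZ gtr0_norm//.
  by rewrite divfK ?gt_eqF// ltr_pdivrMr//; lra.
rewrite functionalZ normrM gtr0_norm// -ltr_pdivlMl// mulr1 => /ltW.
by rewrite !invfM !invrK (mulrC 2).
Qed.

End Functional.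

(* If [u] almost maximizes [phi] on the unit ball, then adding [t v] with [v]
   supported away from [u] raises the norm only by [t^2], so that [phi v] is
   small. *)
Lemma functional_small_off (b : bool) (R : realType) (T : choiceType)
    (phi : tailspace b R T -> R) (e : R) :
  continuous_linear_functional phi -> 0 < e ->
  exists G : seq T, forall v : tailspace b R T,
    (forall i, i \in G -> tailval v i = 0) -> `|phi v| <= e * `|v|.
Proof.
move=> phiP e0; have [C C0 phiC] := functional_bounded phiP.
pose B := [set phi u | u in [set u | `|u| <= 1]].
have supB : has_sup B.
  split; first by exists (phi 0), 0 => //=; rewrite normr0.
  exists C => _ [u /= u1 <-]; apply: (le_trans (ler_norm _)).
  by rewrite (le_trans (phiC u))// ger_pMr.
pose m := sup B.
have mP u : `|u| <= 1 -> phi u <= m by move=> u1; apply: sup_upper_bound => //; exists u.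
have m0 : 0 <= m.
  have := mP 0; rewrite normr0 ler01 => /(_ isT).
  by rewrite -(scale0r 0) (functionalZ phiP) mul0r.
have mZ u k : 0 < k -> `|u| <= k -> phi u <= m * k.
  move=> k0 uk; have := mP (k^-1 *: u); rewrite (functionalZ phiP) normrZ gtr0_norm ?invr_gt0//.
  by rewrite mulrC ler_pdivrMr// mul1r => /(_ uk); rewrite mulrC ler_pdivrMr.
(* Comparing norms will give [t * phi v <= m * t ^+ 2 + d * (1 + C)]. The choice of [t] ensures
   [m * t <= e / 2], and [d] is such that [d * (1 + C) = t * (e / 2)]. *)
pose t := e / (2 * (m + 1)).
have t0 : 0 < t by rewrite divr_gt0// mulr_gt0// ltr_wpDl.
pose d := t * e / (2 * (1 + C)).
have d0 : 0 < d by apply: divr_gt0; apply: mulr_gt0 => //; exact: addr_gt0.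
have [_ [u /= u1 <-] mu] := sup_adherent d0 supB.
have /asboolP/(_ d d0)[G Gu] := tailvalP u.
exists G.
pose uG := trunc (fun i => i \in G) u.
have phiuG : m - d - C * d <= phi uG.
  have : `|trunc (predC (fun i => i \in G)) u| <= d.
    by apply: trunc_norm_le => s us /allP sG; exact: Gu.
  rewrite -(ler_pM2l C0) => /(le_trans (phiC _)) /(le_trans (ler_norm _)).
  move: mu; rewrite -{1}(truncDC (fun i => i \in G) u) (functionalD phiP) -/uG.
  by rewrite -/m; move: (phi uG) (phi _) (C * d) => x y z; lra.
have main v : (forall i, i \in G -> tailval v i = 0) -> `|v| <= 1 -> phi v <= e.
  move=> vG v1; have : phi (uG + t *: v) <= m * (1 + t ^+ 2).
    have t2 : 0 < 1 + t ^+ 2 by rewrite ltr_pwDl// sqr_ge0.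
    (* The squared norm is at most [1 + t ^+ 2], which is below its own square, so [1 + t ^+ 2]
       bounds the norm as well. *)
    apply: mZ => //; rewrite -(@ler_pXn2r _ 2)// ?nnegrE ?(ltW t2)//.
    apply: (@le_trans _ _ (1 + t ^+ 2)); last by rewrite ler_eXnr// lerDl sqr_ge0.
    apply: (le_trans (norm_disjoint_sqr (P := fun i => i \in G) _ _)).
    - by move=> i /negbTE iG; rewrite /= /cutoff iG.
    - by move=> i iG; rewrite -[LHS]/(t * tailval v i) vG// mulr0.
    have uG1 : `|uG| <= 1 by exact: le_trans (trunc_le_norm _ _) u1.
    rewrite normrZ (gtr0_norm t0) exprMn lerD//.
      by rewrite expr_le1.
    by rewrite ger_pMr ?exprn_gt0// expr_le1.
  rewrite (functionalD phiP) (functionalZ phiP) => H.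
  have tv : t * phi v <= m * t ^+ 2 + d * (1 + C).
    by move: phiuG H; move: (phi uG) (phi v) (t ^+ 2) => a c q; lra.
  rewrite -(ler_pM2l t0); apply: (le_trans tv).
  have -> : d * (1 + C) = t * (e / 2).
    by rewrite /d; field; rewrite gt_eqF// addr_gt0.
  have : m * t <= e / 2.
    rewrite /t mulrA ler_pdivrMr ?mulr_gt0 ?ltr_wpDl//.
    by move: m0 e0; move: (m) => k; nra.
  by rewrite -(ler_pM2l t0) expr2; lra.
move=> v vG; have [->|v0] := eqVneq v 0.
  by rewrite -(scale0r 0) (functionalZ phiP) mul0r normrZ normr0 mul0r mulr0.
have nv : 0 < `|v| by rewrite normr_gt0.
have vn1 : `| `|v|^-1 *: v| <= 1 by rewrite normrZ gtr0_norm ?invr_gt0// mulVf ?gt_eqF.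
have vn0 i : i \in G -> tailval (`|v|^-1 *: v) i = 0.
  by move=> iG; rewrite -[LHS]/(`|v|^-1 * tailval v i) vG// mulr0.
have := main _ vn0 vn1; rewrite (functionalZ phiP) ler_pdivrMl// mulrC => pv.
have := main (- (`|v|^-1 *: v)); rewrite normrN => /(_ _ vn1).
rewrite (functionalN phiP) (functionalZ phiP) -mulrN ler_pdivrMl// (mulrC _ e) => nvP.
rewrite ler_norml pv andbT lerNl; apply: nvP => i iG.
by rewrite -[LHS]/(- tailval (`|v|^-1 *: v) i) vn0// oppr0.
Qed.

(** A point of [A] turns [X] into a pointed space, to which [compact_cover] applies; an empty [A] is
    covered by the empty family. *)
Lemma compact_finite_subcover (X : topologicalType) (A : set X) (I : choiceType)
    (D : set I) (f : I -> set X) :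
  compact A -> (forall i, D i -> open (f i)) -> A `<=` cover D f ->
  finite_subset_cover D f A.
Proof.
move=> cA fo Af.
have [[x0 _]|A0] := pselect (exists x, A x); last first.
  by exists fset0%fset => // x Ax; case: A0; exists x.
pose pX : ptopologicalType :=
  HB.pack (Topological.sort X) (isPointed.Build (Topological.sort X) x0).
have := cA : @compact pX A; rewrite compact_cover; exact.
Qed.

(* The values of a function continuous into the weak topology stay close once
   finitely many coordinates do, since functionals are small far out. *)
Lemma functional_comp_continuous (b : bool) (R : realType) (T : choiceType)
    (X : topologicalType) (h : X -> tailspace b R T) (M : R)
    (phi : tailspace b R T -> R) :
  (forall x, `|h x| <= M) ->
  (forall i, continuous (fun x => tailval (h x) i)) ->
  continuous_linear_functional phi -> continuous (phi \o h).
Proof.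
move=> hM hc phiP x; apply/cvgrPdist_le => /= e e0.
have [C C0 phiC] := functional_bounded phiP.
have M1 : 0 < M + 1 by rewrite ltr_wpDl// (le_trans _ (hM x)).
have e2 : 0 < e / 2 by rewrite divr_gt0.
(* [h x - h y] has norm at most [2 * (M + 1)], so its part off [G] changes [phi] by at most [e / 2];
   the tolerance [d] below leaves the other [e / 2] to the coordinates in [G]. *)
pose e' := e / (4 * (M + 1)).
have e'0 : 0 < e' by rewrite divr_gt0// mulr_gt0.
have [G phiG] := functional_small_off phiP e'0.
pose d := e / 2 / C / (size G).+1%:R.
have d0 : 0 < d by rewrite !divr_gt0.
have : \forall y \near x, forall i, i \in G -> `|tailval (h x) i - tailval (h y) i| <= d.
  elim: (G) => [|i s IH]; first by apply: filterE.
  have /cvgrPdist_le/(_ d d0) hi := hc i x.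
  apply: filterS (filterI hi IH) => y [yi ys] j.
  by rewrite inE => /predU1P[->|/ys].
apply: filterS => y yG; rewrite -functionalN// -functionalD//.
rewrite -(truncDC (fun i => i \in G) (h x - h y)) (functionalD phiP).
rewrite (splitr e); apply: (le_trans (ler_normD _ _)); apply: lerD.
  apply: (le_trans (phiC _)); rewrite -ler_pdivlMl// mulrC.
  apply: (@le_trans _ _ ((size G)%:R * d)).
    by apply: trunc_norm_le_size => //; exact: ltW.
  by rewrite /d mulrCA ger_pMr ?divr_gt0// ler_pdivrMr// mul1r ler_nat.
apply: (@le_trans _ _ (e' * (2 * (M + 1)))).
  apply: (le_trans (phiG _ _)) => [i iG|].
    by rewrite /= /cutoff /= iG.
  rewrite ler_wpM2l ?(ltW e'0)//; apply: (le_trans (trunc_le_norm _ _)).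
  by apply: (le_trans (ler_normB _ _)); have := hM x; have := hM y; lra.
by rewrite /e' le_eqVlt; apply/orP; left; apply/eqP; field; rewrite gt_eqF.
Qed.

Lemma contractive_functional (R : realType) (V : normedModType R) (phi : V -> R) :
  (forall u v, phi (u + v) = phi u + phi v) ->
  (forall c u, phi (c *: u) = c * phi u) ->
  (forall u, `|phi u| <= `|u|) -> continuous_linear_functional phi.
Proof.
move=> phiD phiZ phi_le; split=> // u; apply/cvgrPdist_le => e e0.
apply/nbhs_ballP; exists e => //= v; rewrite -ball_normE /= => /ltW uv.
rewrite -mulN1r -phiZ -phiD scaleN1r; exact: le_trans (phi_le _) uv.
Qed.

Lemma tailval_functional (b : bool) (R : realType) (T : choiceType) (i : T) :
  continuous_linear_functional (fun u : tailspace b R T => tailval u i).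
Proof. by apply: contractive_functional => // u; exact: tailval_le_norm. Qed.

Lemma weak_open_preimage (R : realType) (V : normedModType R)
    (X : topologicalType) (h : X -> V) :
  (forall phi, continuous_linear_functional phi -> continuous (phi \o h)) ->
  forall W, weak_open W -> open (h @^-1` W).
Proof.
move=> hc W Wo; rewrite openE => x /= /Wo[n [fs [e [e0 fsP sW]]]].
have : \forall y \near x, forall i, (i < n)%N -> `|fs i (h y) - fs i (h x)| < e.
  elim: (n) fsP => [|m IH] fsP; first by apply: filterE.
  have /cvgrPdist_lt/(_ e e0) hm := hc _ (fsP m (ltnSn m)) x.
  have IH' := IH (fun i im => fsP i (ltnW im)).
  apply: filterS (filterI hm IH') => y [ym yi] i.
  by rewrite ltnS leq_eqVlt => /predU1P[->|/yi//]; rewrite distrC.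
by apply: filterS => y hy; exact: sW.
Qed.

Lemma tailspace_embedding (b : bool) (R : realType) (T : choiceType)
    (X : topologicalType) (h : X -> tailspace b R T) (M : R) :
  compact [set: X] -> (forall x, `|h x| <= M) ->
  (forall i, continuous (fun x => tailval (h x) i)) -> injective h ->
  @weakly_compact_embeds R (tailspace b R T) X.
Proof.
move=> cX hM hc hI.
have hW := weak_open_preimage (fun phi => functional_comp_continuous hM hc).
exists h, (h @` setT); split=> //.
- move=> C Co hC.
  have [|D' DC hD] := @compact_finite_subcover X setT _ C (fun W => h @^-1` W)
      cX (fun W CW => hW W (Co W CW)).
    by move=> x _; have [W CW hx] := hC (h x) (ex_intro2 _ _ x I erefl); exists W.
  exists [set` D']; first by split=> // W /DC /set_mem.
  by move=> _ [x _ <-]; have [W DW] := hD x I; exists W.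
- move=> U Uo; exists (~` (h @` ~` U)); last first.
    apply/seteqP; split=> [_ [x Ux <-]|_ [] /[swap] -[x _ <-] nU].
      by split; [move=> [y nUy /hI yx]; apply: nUy; rewrite yx|exists x].
    by exists x => //; apply: contrapT => nUx; apply: nU; exists x.
  move=> v nv.
  (* The points whose coordinate [p.1] is farther than [1 / (p.2 + 1)] from that of [v]. Since [v]
     is not in the image of [~] U[, these open sets cover]~[U], and the largest [p.2] of a finite
     subcover fixes a common tolerance. *)
  pose O (p : T * nat) := [set x | p.2.+1%:R^-1 < `|tailval (h x) p.1 - tailval v p.1|].
  have Oo p : open (O p).
    have : continuous (fun x => `|tailval (h x) p.1 - tailval v p.1|).
      move=> x; apply: cvg_norm; apply: cvgB; [exact: hc|exact: cvg_cst].
    by move=> /continuousP/(_ _ (@open_gt R p.2.+1%:R^-1)).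
  have cU : compact (~` U) by apply: (subclosed_compact _ cX) => //; exact: open_closedC.
  have [|D' _ UD] := @compact_finite_subcover X _ _ setT O cU (fun p _ => Oo p).
    move=> x nUx.
    have [i hi] : exists i, tailval (h x) i != tailval v i.
      apply: contrapT => /forallNP hxv; apply: nv; exists x => //.
      by apply: tailval_inj; apply/funext => i; have /negP/negPn/eqP := hxv i.
    have : 0 < `|tailval (h x) i - tailval v i| by rewrite normr_gt0 subr_eq0.
    by move=> /ltr_add_invr[k]; rewrite add0r => hk; exists (i, k).
  pose s := finmap.enum_fset D'.
  pose N := (\max_(p <- s) p.2)%N.
  have sD p : (p \in s) = (p \in D') by [].
  have sN p : p \in s -> (p.2 <= N)%N by move=> ps; exact: leq_bigmax_seq.
  pose fs (p0 : T * nat) j (u : tailspace b R T) := tailval u (nth p0 s j).1.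
  have key u : (forall p, p \in s -> `|tailval u p.1 - tailval v p.1| < N.+1%:R^-1) ->
      (~` (h @` ~` U)) u.
    move=> uv [x nUx hxu]; have [p pD] := UD x nUx; rewrite /O/= hxu => hp.
    have pN := sN p pD; have := lt_trans hp (uv p pD).
    by rewrite ltf_pV2 ?posrE// ltr_nat ltnS ltnNge pN.
  (* With an empty subcover there is no index to serve as the default of [nth]; then the condition
     is void and no functional is required. *)
  case E : s => [|p0 s'].
    by exists 0%N, (fun _ _ => 0), 1; split=> // u _; apply: key => p; rewrite E.
  exists (size s), (fs p0), N.+1%:R^-1; split; first by rewrite invr_gt0.
    by move=> j _; exact: tailval_functional.
  move=> u /= uP; apply: key => p ps.
  by have := uP (index p s); rewrite index_mem ps /fs nth_index//; exact.
Qed.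

(** * The inner product *)

Section HilbertCase.
Variables (R : realType) (T : choiceType).
Local Notation V := (tailspace true R T).
Implicit Types (u v w : V) (s : seq T).

Lemma fgauge_sqr s (f : T -> R^o) : fgauge true s f ^+ 2 = \sum_(i <- s) f i ^+ 2.
Proof.
elim: s => [|i s IH] /=; first by rewrite big_nil expr0n.
by rewrite big_cons -IH /hjoin sqr_sqrtr ?addr_ge0 ?sqr_ge0// real_normK ?num_real.
Qed.

(** A list [G] nearly attains the supremum and larger lists do at least as well. Writing a
    difference of squares as a product, with sum factor at most [2 * |u|], carries this over to
    squares; the [+ 1] in [d] covers [u = 0]. *)
Lemma norm_sqr_approx u e : 0 < e -> exists G : seq T,
  forall s, uniq s -> {subset G <= s} ->
    `| `|u| ^+ 2 - \sum_(i <- s) tailval u i ^+ 2| <= e.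
Proof.
move=> e0; pose d := e / (2 * `|u| + 1).
have d0 : 0 < d by rewrite divr_gt0// ltr_wpDl// mulr_ge0.
have supu : has_sup [set fgauge true s (tailval u) | s in [set s | uniq s]].
  split; first by exists (fgauge true [::] (tailval u)), [::].
  by exists `|u| => _ [s us <-]; exact: fgauge_le_tail_norm.
have [_ [G /= uG <-]] := sup_adherent d0 supu.
rewrite -/(tail_norm u) -tailspace_normE => uGd.
exists G => s us Gs; rewrite -fgauge_sqr.
have su : fgauge true s (tailval u) <= `|u| by exact: fgauge_le_tail_norm.
have Gsu : fgauge true G (tailval u) <= fgauge true s (tailval u).
  rewrite -(@ler_pXn2r _ 2)// ?nnegrE ?fgauge_ge0// !fgauge_sqr.
  have Gp : perm_eq G [seq i <- s | i \in G].
    apply: uniq_perm; rewrite ?filter_uniq// => i; rewrite mem_filter.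
    by case: (boolP (i \in G)) => // /Gs ->.
  rewrite (perm_big _ Gp) big_filter [leRHS](bigID (fun i => i \in G))/=.
  by rewrite lerDl sumr_ge0// => i _; exact: sqr_ge0.
rewrite subr_sqr normrM ger0_norm ?subr_ge0// ger0_norm; last first.
  by rewrite addr_ge0 ?fgauge_ge0.
apply: (@le_trans _ _ (d * (2 * `|u|))); last first.
  by rewrite /d -mulrA ger_pMr// mulrC ler_pdivrMr ?mul1r ?lerDl// ltr_wpDl// mulr_ge0.
apply: ler_pM; rewrite ?subr_ge0 ?addr_ge0 ?fgauge_ge0//.
  by rewrite lerBlDr -lerBlDl (le_trans (ltW uGd)).
by rewrite mulr_natl mulr2n lerD2l.
Qed.

(* Defined by polarization, so that no infinite sum has to be formed. *)
Definition tail_ip u v : R := (`|u + v| ^+ 2 - `|u - v| ^+ 2) / 4.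

Lemma tail_ip_approx u v e : 0 < e -> exists G : seq T,
  forall s, uniq s -> {subset G <= s} ->
    `|tail_ip u v - \sum_(i <- s) tailval u i * tailval v i| <= e.
Proof.
move=> e0.
have [G Gp] := norm_sqr_approx (u + v) e0.
have [H Hm] := norm_sqr_approx (u - v) e0.
exists (G ++ H) => s us GHs.
have /(Gp s us) {}Gp : {subset G <= s}.
  by move=> i iG; apply: GHs; rewrite mem_cat iG.
have /(Hm s us) {}Hm : {subset H <= s}.
  by move=> i iH; apply: GHs; rewrite mem_cat iH orbT.
have -> : \sum_(i <- s) tailval u i * tailval v i =
    (\sum_(i <- s) tailval (u + v) i ^+ 2 - \sum_(i <- s) tailval (u - v) i ^+ 2) / 4.
  rewrite -sumrB mulr_suml; apply: eq_bigr => i _.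
  rewrite -[tailval (u + v) i]/(tailval u i + tailval v i).
  by rewrite -[tailval (u - v) i]/(tailval u i - tailval v i); field.
move: Gp Hm; rewrite /tail_ip !ler_norml.
move: (\sum_(i <- s) _) (\sum_(i <- s) _) (`|u + v| ^+ 2) (`|u - v| ^+ 2) => x y z t.
by lra.
Qed.

(** Additivity and homogeneity are exact for finite sums over a list containing all the exceptional
    lists, so the two sides differ by at most any positive [e]. Symmetry and the value on the
    diagonal are read off the polarization formula. *)
Lemma tail_ip_inner_product : inner_product tail_ip.
Proof.
have eq_le (x y : R) : (forall e : R, 0 < e -> `|x - y| <= e) -> x = y.
  move=> xy; apply/eqP; rewrite -subr_eq0 -normr_le0.
  by apply/ler_addgt0Pr => e /xy; rewrite add0r.
have sub_cat (G H K s : seq T) : {subset G ++ H ++ K <= s} ->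
    [/\ {subset G <= s}, {subset H <= s} & {subset K <= s}].
  by move=> sub; split=> i iG; apply: sub; rewrite !mem_cat iG ?orbT.
split=> [u v w|c u v|u v|u].
- apply: eq_le => e e0; have e3 : 0 < e / 3 by rewrite divr_gt0.
  have [G Gp] := tail_ip_approx (u + v) w e3.
  have [H Hp] := tail_ip_approx u w e3.
  have [K Kp] := tail_ip_approx v w e3.
  pose s := undup (G ++ H ++ K); have us : uniq s by exact: undup_uniq.
  have [|Gs Hs Ks] := sub_cat G H K s; first by move=> i; rewrite mem_undup.
  move: (Gp s us Gs) (Hp s us Hs) (Kp s us Ks).
  have -> : \sum_(i <- s) tailval (u + v) i * tailval w i =
     \sum_(i <- s) tailval u i * tailval w i + \sum_(i <- s) tailval v i * tailval w i.
    by rewrite -big_split; apply: eq_bigr => i _; exact: mulrDl.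
  rewrite !ler_norml; move: (\sum_(i <- s) _) (\sum_(i <- s) _) => x y.
  by move: (tail_ip _ _) (tail_ip _ _) (tail_ip _ _) => z1 z2 z3; lra.
- apply: eq_le => e e0; pose d := e / (1 + `|c|).
  have c1 : 0 < 1 + `|c| by rewrite ltr_pwDl.
  have d0 : 0 < d by rewrite divr_gt0.
  have [G Gp] := tail_ip_approx (c *: u) v d0.
  have [H Hp] := tail_ip_approx u v d0.
  pose s := undup (G ++ H ++ [::]); have us : uniq s by exact: undup_uniq.
  have [|Gs Hs _] := sub_cat G H [::] s; first by move=> i; rewrite mem_undup.
  move: (Gp s us Gs) (Hp s us Hs).
  have -> : \sum_(i <- s) tailval (c *: u) i * tailval v i =
     c * \sum_(i <- s) tailval u i * tailval v i.
    by rewrite mulr_sumr; apply: eq_bigr => i _; rewrite mulrA.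
  move: (\sum_(i <- s) _) (tail_ip (c *: u) v) (tail_ip u v) => x y z Hy Hz.
  have -> : y - c * z = (y - c * x) - c * (z - x) by ring.
  apply: (le_trans (ler_normB _ _)); rewrite normrM.
  apply: (@le_trans _ _ (d + `|c| * d)); first by rewrite lerD// ler_wpM2l.
  by rewrite -{1}(mul1r d) -mulrDl mulrC divfK ?gt_eqF.
- by rewrite /tail_ip (addrC u v) (distrC u v).
- rewrite /tail_ip subrr normr0 expr0n subr0 -mulr2n -scaler_nat normrZ.
  by rewrite normr_nat exprMn; field.
Qed.

End HilbertCase.

(** * Embeddings from point-finite families of functions *)

Lemma geometric_small (R : realType) (e : R) : 0 < e -> exists N, 2^-1 ^+ N <= e.
Proof.
move=> /ltr_add_invr[N]; rewrite add0r => Ne; exists N; apply: le_trans (ltW Ne).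
by rewrite exprVn lef_pV2 ?posrE ?exprn_gt0// -natrX ler_nat ltn_expl.
Qed.

Section Families.
Variables (R : realType) (X : topologicalType) (U : nat -> set (X -> R)).
Hypothesis cX : compact [set: X].
Hypothesis Uc : forall n f, U n f -> continuous f.
Hypothesis U01 : forall n f x, U n f -> `|f x| <= 1.
Hypothesis Usep : forall x y, x <> y -> exists n f, U n f /\ f x <> f y.
Hypothesis Ufin : forall n x, finite_set [set f | U n f /\ f x != 0].

Local Notation T := (nat * (X -> R))%type.

(* The coordinates are indexed by pairs (number of the family, function); the
   index set is all of [nat * (X -> R)], with [0] outside the families. *)
Definition weighted_coord (w : nat -> R) x : T -> R^o :=
  fun p => if `[< U p.1 p.2 >] then w p.1 * p.2 x else 0.

Lemma weighted_coord_support w x p :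
  weighted_coord w x p != 0 -> U p.1 p.2 /\ p.2 x != 0.
Proof.
rewrite /weighted_coord; case: asboolP => [Up|_]; last by rewrite eqxx.
by rewrite mulf_eq0 negb_or => /andP[].
Qed.

Lemma weighted_coord_le w x p : 0 <= w p.1 -> `|weighted_coord w x p| <= w p.1.
Proof.
move=> w0; rewrite /weighted_coord; case: asboolP => [Up|_]; last by rewrite normr0.
by rewrite normrM (ger0_norm w0) ler_piMr//; exact: U01 Up.
Qed.

Variables (b : bool) (w : nat -> R).
Hypothesis w0 : forall n, 0 < w n.
Hypothesis wtail : forall N x (s : seq T), uniq s ->
  (forall p, p \in s -> (N <= p.1)%N) ->
  fgauge b s (weighted_coord w x) <= 2 * 2^-1 ^+ N.

(** From level [N] on, [wtail] makes the contribution small. In each earlier level only finitely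
    many functions are nonzero at [x], and these form the exceptional list. *)
Lemma weighted_coord_null_tail x : weighted_coord w x \in @null_tail b R T.
Proof.
apply/asboolP => e e0.
have [N Ne] := geometric_small (divr_gt0 e0 (ltr0n _ 2)).
rewrite -(ler_pM2l (ltr0n R 2)) mulrCA divff// mulr1 in Ne.
have /choice[l lP] : forall n, exists l : seq (X -> R), [set f | U n f /\ f x != 0] = [set` l].
  by move=> n; have /finite_seqP := Ufin n x.
exists [seq (n, f) | n <- iota 0 N, f <- l n] => s us sG.
apply: le_trans Ne.
apply: (le_trans (fgauge_le_filterD b (fun p : T => (p.1 < N)%N) _ _)).
rewrite -[leRHS]add0r; apply: lerD; last first.
  apply: wtail => [|p]; first exact: filter_uniq.
  by rewrite mem_filter -leqNgt => /andP[].
rewrite -(mulr0 (size [seq p <- s | (p.1 < N)%N])%:R).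
apply: fgauge_le_size => -[n f]; rewrite mem_filter /= => /andP[nN /sG]; rewrite normr_le0.
apply: contraNT => /weighted_coord_support/= fx.
apply/allpairsPdep; exists n, f; split=> //; first by rewrite mem_iota.
by have : [set` l n] f by rewrite -lP.
Qed.

Lemma families_embedding : @weakly_compact_embeds R (tailspace b R T) X.
Proof.
pose h x := TailSpace (weighted_coord_null_tail x).
(* The bound 2 is [wtail] at [N = 0]. *)
apply: (@tailspace_embedding b R T X h 2) => //.
- move=> x; apply: tail_norm_le => s us; rewrite -[leRHS]mulr1 -(expr0 (2^-1)).
  exact: wtail.
- move=> [n f] /=; rewrite /weighted_coord /=; case: asboolP => [Uf|_] x; last exact: cvg_cst.
  by apply: cvgM; [exact: cvg_cst|exact: (Uc Uf)].
- move=> x y /(congr1 (@tailval b R T)) /= xy; apply: contrapT => /Usep[n [f [Uf]]]; apply.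
  have /(congr1 (fun g => g (n, f))) := xy; rewrite /weighted_coord/= asboolT//.
  by move=> /(mulfI (negbT (gt_eqF (w0 n)))).
Qed.

End Families.

Lemma eberlein_of_families (R : realType) (X : topologicalType)
    (U : nat -> set (X -> R)) : compact [set: X] ->
  (forall n f, U n f -> continuous f) ->
  (forall n f x, U n f -> `|f x| <= 1) ->
  (forall x y, x <> y -> exists n f, U n f /\ f x <> f y) ->
  (forall n x, finite_set [set f | U n f /\ f x != 0]) ->
  eberlein_compact R X.
Proof.
move=> cX Uc U01 Usep Ufin.
exists (tailspace false R (nat * (X -> R))%type).
(* In the sup norm the number of nonzero coordinates in a level is irrelevant, so geometric weights
   suffice. *)
have w0 n : 0 < (2^-1 ^+ n : R) by rewrite exprn_gt0.
apply: (families_embedding cX Uc Usep Ufin w0) => N x s _ sN.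
apply: (@le_trans _ _ (2^-1 ^+ N)); last by rewrite ler_pMl ?ler1n.
have : forall p, p \in s -> `|weighted_coord U (fun n => 2^-1 ^+ n) x p| <= 2^-1 ^+ N.
  move=> p /sN Np; apply: (le_trans (weighted_coord_le U01 _ (ltW (w0 _)))).
  by rewrite ler_wiXn2l// ?invr_ge0// invf_le1// ler1n.
elim: s {sN} => [_|p s IH sP] /=; first exact: ltW.
by rewrite /hjoin ge_max sP ?mem_head// IH// => q qs; rewrite sP// inE qs orbT.
Qed.

Lemma finite_set_bounded (T : choiceType) (A : set T) k :
  (forall s : seq T, uniq s -> (forall i, i \in s -> A i) -> (size s <= k)%N) ->
  finite_set A.
Proof.
move=> Ak; apply: contrapT => /(infinite_set_fset k.+1)[B BA].
by rewrite ltnNge Ak.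
Qed.

Lemma uniform_eberlein_of_families (R : realType) (X : topologicalType)
    (U : nat -> set (X -> R)) : compact [set: X] ->
  (forall n f, U n f -> continuous f) ->
  (forall n f x, U n f -> `|f x| <= 1) ->
  (forall x y, x <> y -> exists n f, U n f /\ f x <> f y) ->
  (forall n, exists k, forall x (s : seq (X -> R)), uniq s ->
     (forall f, f \in s -> U n f /\ f x != 0) -> (size s <= k)%N) ->
  uniform_eberlein_compact R X.
Proof.
move=> cX Uc U01 Usep /choice[k Uk].
exists (tailspace true R (nat * (X -> R))%type), (@tail_ip R (nat * (X -> R))%type).
split; first exact: tail_ip_inner_product.
have Ufin n x : finite_set [set f | U n f /\ f x != 0].
  exact: finite_set_bounded (Uk n x).
(* At most [k n] functions of level [n] are nonzero at a point, so dividing by [(k n).+1] keeps the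
   absolute sum of that level below [2^-1 ^+ n]. The Euclidean gauge is then bounded by the total
   absolute sum. *)
pose w n : R := 2^-1 ^+ n / (k n).+1%:R.
have w0 n : 0 < w n by rewrite divr_gt0 ?exprn_gt0.
apply: (families_embedding cX Uc Usep Ufin w0) => N x s us sN.
apply: (le_trans (fgauge_le_sum _ _ _)).
have level n (t : seq (nat * (X -> R))) : uniq t ->
    \sum_(p <- t | p.1 == n) `|weighted_coord U w x p| <= 2^-1 ^+ n.
  move=> ut; pose t' := [seq p <- t | (p.1 == n) && (weighted_coord U w x p != 0)].
  have -> : \sum_(p <- t | p.1 == n) `|weighted_coord U w x p| =
      \sum_(p <- t') `|weighted_coord U w x p|.
    rewrite big_filter big_mkcondr; apply: eq_bigr => p _.
    by case: eqVneq => [->|//]; rewrite normr0.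
  apply: (@le_trans _ _ ((size t')%:R * w n)).
    rewrite -sum1_size natr_sum mulr_suml big_seq [leRHS]big_seq.
    apply: ler_sum => p; rewrite mem_filter mul1r => /andP[/andP[/eqP <- _] _].
    exact: weighted_coord_le (ltW (w0 _)).
  rewrite mulrCA ger_pMr ?exprn_gt0// ler_pdivrMr// mul1r ler_nat.
  apply: leqW; rewrite -(size_map snd); apply: (Uk n x).
    rewrite map_inj_in_uniq ?filter_uniq// => -[n1 f] [n2 g].
    by rewrite !mem_filter /= => /andP[/andP[/eqP-> _] _] /andP[/andP[/eqP-> _] _] ->.
  move=> _ /mapP[p + ->]; rewrite mem_filter => /andP[/andP[/eqP pn /weighted_coord_support]].
  by rewrite pn.
(* The right side is the finite geometric sum over the levels from [N] to [N + M - 1]. *)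
have main M : forall t : seq (nat * (X -> R)), uniq t ->
    (forall p, p \in t -> (N <= p.1 < N + M)%N) ->
    \sum_(p <- t) `|weighted_coord U w x p| <= 2 * 2^-1 ^+ N - 2 * 2^-1 ^+ (N + M).
  elim: M => [|M IH] t ut tN.
    rewrite addn0 subrr; case: t ut tN => [|p t] _ tN; first by rewrite big_nil.
    by have := tN p (mem_head _ _); rewrite addn0; case: leqP.
  rewrite (bigID (fun p => p.1 == N + M)%N)/=.
  apply: (le_trans (lerD (level _ _ ut) _)).
    rewrite -big_filter; apply: IH; first exact: filter_uniq.
    move=> p; rewrite mem_filter => /andP[pM /tN/andP[-> /=]].
    by rewrite addnS ltnS leq_eqVlt (negbTE pM).
  by rewrite addnS exprS; lra.
apply: (le_trans (main (\max_(p <- s) p.1).+1 s us _)).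
  move=> p ps; rewrite sN//= addnS ltnS; apply: leq_trans (leq_addl _ _).
  exact: leq_bigmax_seq.
by rewrite gerBl mulr_ge0// exprn_ge0.
Qed.

(** * Point-finite families and countable bases *)

Section PointFinite.
Variable X : topologicalType.
Implicit Types (S A V : set X) (B : set (set X)).

(** The largest open set of [X] whose trace on [S] lies in [A]. *)
Definition extend S A : set X := ~` closure (S `\` A).

Lemma extend_open S A : open (extend S A).
Proof. by apply: closed_openC; exact: closed_closure. Qed.

Lemma extend_cap_sub S A : extend S A `&` S `<=` A.
Proof.
by move=> x [nx Sx]; apply: contrapT => nAx; apply: nx; exact: subset_closure.
Qed.

Lemma sub_extend S A V : open V -> A = V `&` S -> A `<=` extend S A.
Proof.
move=> Vo -> x [Vx Sx] /(_ V (open_nbhs_nbhs (conj Vo Vx)))[y [[Sy]]].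
by move=> nVS Vy; exact: nVS.
Qed.

(** Near a point of the open set [extend S A], points of [S] lie in [A]. Thus on [closure S] an
    extension grows no further than [closure A]. *)
Lemma extend_cap_closure S A : extend S A `&` closure S `<=` closure A.
Proof.
move=> x [Ex Sx] N Nx.
have /Sx[y [Sy [Ey Ny]]] : nbhs x (extend S A `&` N).
  by apply: filterI => //; apply: open_nbhs_nbhs; split=> //; exact: extend_open.
by exists y; split=> //; exact: (@extend_cap_sub S A y (conj Ey Sy)).
Qed.

Lemma infinite_countable_subset (T : pointedType) (A : set T) : infinite_set A ->
  exists F, [/\ F `<=` A, countable F & ~ finite_set F].
Proof.
move=> /infiniteP/pcard_leP[f]; exists (f @` setT); split.
- by move=> _ [n _ <-]; exact: (@funS _ _ _ _ f n I).
- exact: card_image_le.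
- have /eq_finite_set -> : (f @` setT #= [set: nat])%card by exact: card_image.
  exact: infinite_nat.
Qed.

Lemma near_all_finite (T : eqType) (x : X) (G : set T) (P : T -> set X) :
  finite_set G -> (forall i, G i -> nbhs x (P i)) ->
  nbhs x [set y | forall i, G i -> P i y].
Proof.
move=> /finite_seqP[s ->]; elim: s => [|i s IH] GP; first by apply: filterE.
have IH' := IH (fun j js => GP j (mem_behead (s := i :: s) js)).
apply: filterS (filterI (GP i (mem_head _ _)) IH') => y [yi ys] j /=.
by rewrite inE => /predU1P[->|/ys].
Qed.

(** Finitely many extensions through [x] form a neighbourhood of [x], which meets [S] in a point
    common to the original members. Infinitely many extensions at [x] would therefore contradict
    strong point-finiteness. *)
Lemma strongly_point_finite_extend S B x : strongly_point_finite S B ->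
  closure S x -> finite_set [set A | B A /\ extend S A x].
Proof.
move=> BS Sx; apply: contrapT => /infinite_countable_subset[F [FB Fc Finf]].
have [G [GF Gf GS]] : exists G : set (set X),
    [/\ G `<=` F, finite_set G & S `&` \bigcap_(A in G) A = set0].
  by apply: BS => // A /FB[].
have := near_all_finite Gf (P := extend S) (x := x).
have Gx A : G A -> nbhs x (extend S A).
  by move=> /GF/FB[_ Ax]; apply: open_nbhs_nbhs; split=> //; exact: extend_open.
move=> /(_ Gx)/Sx[y [Sy Ey]].
suff : set0 y by [].
by rewrite -GS; split=> // A /Ey EA; exact: (@extend_cap_sub S A y (conj EA Sy)).
Qed.

Lemma boundedly_strongly_point_finite S B :
  boundedly_point_finite S B -> strongly_point_finite S B.
Proof.
move=> [n Bn] F FB _ /(infinite_set_fset n.+1)[G GF nG].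
exists [set` G]; split=> //.
apply/seteqP; split=> // x [Sx Gx].
pose s := finmap.enum_fset G.
rewrite -(Bn (fun i => nth set0 s i)).
- by split=> // i /= iN; apply: Gx => /=; apply: mem_nth; exact: leq_ltn_trans nG.
- by move=> i iN; apply/FB/GF => /=; apply: mem_nth; exact: leq_ltn_trans nG.
- move=> i j iN jN /eqP; rewrite nth_uniq ?fset_uniq//; last 2 first.
  - exact: leq_ltn_trans nG.
  - exact: leq_ltn_trans nG.
  by move=> /eqP.
Qed.

End PointFinite.

Lemma countable_sub_range (T : pointedType) (A : set T) :
  countable A -> exists g : nat -> T, A `<=` range g.
Proof.
move=> /pfcard_geP[->|[g]]; first by exists (fun=> point) => ? [].
by exists g => x /(surj (f := g)) [n _ <-]; exists n.
Qed.

(** * Mishchenko's lemma *)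

Section CountableBase.
Variable X : topologicalType.
Implicit Types (C : set X) (B : set (set X)).

(** Members are sets of the whole space, and only their traces on [C] have to be small. *)
Definition outer_base C B := forall x (V : set X), C x -> open V -> V x ->
  exists A, [/\ B A, A x & A `&` C `<=` V].

Section Trees.
Variables (pick : seq (set X) -> X) (e : X -> nat -> set X).

(** A finite tree records how a point is reached by iterated picking. There are countably many trees
    labelled by [nat], hence countably many points reached. *)
Definition root (t : GenTree.tree nat) :=
  match t with GenTree.Leaf k => k | GenTree.Node k _ => k end.

(* The label at the root of a subtree only selects which member of the countable
   family [e] at its point is handed over to the parent. *)
Fixpoint tree_point (t : GenTree.tree nat) : X :=
  match t with
  | GenTree.Leaf _ => pick [::]
  | GenTree.Node _ ts => pick [seq e (tree_point t) (root t) | t <- ts]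
  end.

Definition tree_set t := e (tree_point t) (root t).

Lemma tree_set_relabel t k : exists t', tree_set t' = e (tree_point t) k.
Proof.
by case: t => [j|j ts]; [exists (GenTree.Leaf k)|exists (GenTree.Node k ts)].
Qed.

Lemma pick_tree_set (s : seq (set X)) : (forall A, A \in s -> range tree_set A) ->
  exists t, tree_point t = pick s.
Proof.
move=> sR; suff [ts <-] : exists ts, map tree_set ts = s.
  by exists (GenTree.Node 0 ts).
elim: s sR => [|A s IH] sR; first by exists [::].
have [t _ tA] := sR A (mem_head _ _).
have [|ts <-] := IH; first by move=> A' A's; apply: sR; rewrite inE A's orbT.
by exists (t :: ts); rewrite /= tA.
Qed.

End Trees.

(* Mishchenko's lemma. The countable set [D] of all [tree_point]s is closed under
   picking a point of [C] outside any given finite union of members of [B] that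
   meet [D]; compactness then makes [D] dense in [C], so that only countably
   many members of [B] meet [C]. *)
Lemma countable_outer_base C B : hausdorff_space X -> compact C ->
  (forall A, B A -> open A) ->
  (forall x, C x -> countable [set A | B A /\ A x]) ->
  outer_base C B ->
  exists g : nat -> set X, (forall n, open (g n)) /\ outer_base C (range g).
Proof.
move=> hX cC Bo Bc CB.
have [[x0 Cx0]|C0] := pselect (exists x, C x); last first.
  exists (fun=> set0); split=> [_|x V Cx]; first exact: open0.
  by case: C0; exists x.
have /choice[e eP] : forall x, exists g : nat -> set X,
    C x -> [set A | B A /\ A x] `<=` range g.
  move=> x; have [/Bc/countable_sub_range[g gP]|nCx] := pselect (C x).
    by exists g.
  by exists (fun=> set0).
(* [pick s] avoids all sets of [s] whenever some point of [C] does; otherwise it is an arbitrary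
   point of [C]. *)
have /choice[pick pickP] : forall s : seq (set X), exists y, C y /\
    ((exists x, C x /\ forall A, A \in s -> ~ A x) -> forall A, A \in s -> ~ A y).
  move=> s; have [[x [Cx xs]]|ns] := pselect (exists x, C x /\ forall A, A \in s -> ~ A x).
    by exists x.
  by exists x0; split=> // /ns.
have ptC t : C (tree_point pick e t) by case: t => [k|k ts]; exact: (pickP _).1.
pose D := range (tree_point pick e).
have meetD A t : B A -> A (tree_point pick e t) -> range (tree_set pick e) A.
  move=> BA At; have [k _ kA] := eP _ (ptC t) A (conj BA At).
  by have [t' t'E] := tree_set_relabel pick e t k; exists t' => //; rewrite t'E.
have dense A x : C x -> B A -> A x -> A `&` D !=set0.
  move=> Cx BA Ax; apply: contrapT => /set0P/negP/negPn/eqP AD.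
  have nDx : ~ closure D x.
    move=> /(_ A (open_nbhs_nbhs (conj (Bo _ BA) Ax)))[y [Dy Ay]].
    by have : set0 y by rewrite -AD.
  have cD : compact (closure D `&` C).
    by rewrite setIC; apply: compact_closedI => //; exact: closed_closure.
  (* The covering sets meet [D], so they are tree sets and a tree point can be picked for any finite
     subfamily. They all miss [x], so the picked point avoids them, although it lies in [D] and
     should be covered. *)
  have [|D' D'B DD'] := @compact_finite_subcover X _ _
      [set A' | B A' /\ (~ A' x /\ A' `&` D !=set0)] id
      cD (fun A' BA' => Bo _ BA'.1).
    move=> y [Dy Cy]; have [||A' [BA' A'y A'C]] := CB y (~` [set x]) Cy.
    - by apply: closed_openC; apply: accessible_closed_set1; exact: hausdorff_accessible.
    - by move=> /= yx; apply: nDx; rewrite -yx.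
    exists A' => //; split=> //; split; first by move=> A'x; apply: (A'C x) => //.
    have [z [Dz A'z]] := Dy A' (open_nbhs_nbhs (conj (Bo _ BA') A'y)).
    by exists z.
  have [t tE] : exists t, tree_point pick e t = pick (finmap.enum_fset D').
    apply: pick_tree_set => A' /D'B/set_mem[BA' [_ [z [A't [t _ tE]]]]].
    by apply: (meetD _ t) => //; rewrite tE.
  have Ct := ptC t; have Dt : D (tree_point pick e t) by exists t.
  have [A' A'D A't] := DD' _ (conj (subset_closure Dt) Ct).
  have := (pickP (finmap.enum_fset D')).2; rewrite -tE; apply; [|exact: A'D|exact: A't].
  by exists x; split=> // A1 /D'B/set_mem[_ []].
(* The enumerations [e] may also list sets outside [B]; replacing those that are not open by [set0]
   keeps every [g n] open. *)
pose g n := if choice.unpickle n is Some t then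
  (if `[< open (tree_set pick e t) >] then tree_set pick e t else set0) else set0.
exists g; split=> [n|x V Cx Vo Vx].
  rewrite /g; case: choice.unpickle => [t|]; last exact: open0.
  by case: asboolP => // _; exact: open0.
have [A [BA Ax AV]] := CB x V Cx Vo Vx; exists A; split=> //.
have [z [At [t _ tE]]] := dense A x Cx BA Ax.
have [|t' _ t'A] := meetD A t BA; first by rewrite tE.
by exists (choice.pickle t') => //; rewrite /g choice.pickleK t'A asboolT//; exact: Bo.
Qed.

End CountableBase.

(** * Functions on a compact Hausdorff space *)

Section CompactHausdorff.
Variables (R : realType) (X : topologicalType).
Hypothesis cX : compact [set: X].
Hypothesis hX : hausdorff_space X.
Implicit Types (A B C S V : set X).

Lemma open_shrink x V : open V -> V x ->
  exists W, [/\ open W, W x & closure W `<=` V].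
Proof.
move=> Vo Vx.
have [N Nx NV] := compact_regular hX cX (filterT : nbhs x setT)
  (open_nbhs_nbhs (conj Vo Vx)).
exists N°; split; [exact: open_interior|exact: Nx|].
by apply: subset_trans NV; apply: closureS; exact: interior_subset.
Qed.

Lemma urysohn_unit A B : closed A -> closed B -> A `&` B = set0 ->
  exists f : X -> R, [/\ continuous f, (forall x, A x -> f x = 0),
    (forall x, B x -> f x = 1) & forall x, `|f x| <= 1].
Proof.
move=> cA cB AB.
have [f [fc fA fB f01]] := urysohn_ext_itv (compact_normal hX cX) cA cB AB (@ltr01 R).
exists f; split=> // x; [by move=> Ax; exact: (fA _ (ex_intro2 _ _ x Ax erefl))| |].
  by move=> Bx; exact: (fB _ (ex_intro2 _ _ x Bx erefl)).
have /f01/= : range f (f x) by exists x.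
by rewrite in_itv/= => /andP[f0 f1]; rewrite ger0_norm.
Qed.

(** One Urysohn function is taken for each pair of members whose traces on [C] have disjoint
    closures. Regularity finds such a pair around any two distinct points of [C]; the remaining
    pairs receive the zero function. *)
Lemma countable_separating_functions C g : closed C -> 
  (forall n : nat, open (g n)) -> outer_base C (range g) ->
  exists u : nat -> X -> R, [/\ (forall n, continuous (u n)),
    (forall n x, `|u n x| <= 1) &
    forall x y, C x -> C y -> x <> y -> exists n, u n x <> u n y].
Proof.
move=> cC go gC.
have /choice[v vP] : forall p : nat * nat, exists f : X -> R,
    [/\ continuous f, (forall x, `|f x| <= 1) &
      closure (g p.1 `&` C) `&` closure (g p.2 `&` C) = set0 ->
      (forall x, (g p.1 `&` C) x -> f x = 0) /\
      (forall x, (g p.2 `&` C) x -> f x = 1)].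
  move=> p; have [p0|np] := pselect (closure (g p.1 `&` C) `&` closure (g p.2 `&` C) = set0).
    have [f [fc f0 f1 fb]] := urysohn_unit (@closed_closure _ _) (@closed_closure _ _) p0.
    by exists f; split=> // _; split=> x gx; [apply: f0|apply: f1]; exact: subset_closure.
  by exists (fun=> 0); split=> // x; [exact: cvg_cst|rewrite normr0].
exists (fun n => if choice.unpickle n is Some p then v p else fun=> 0); split.
- by move=> n; case: choice.unpickle => [p|]; [have [] := vP p|move=> x; exact: cvg_cst].
- by move=> n x; case: choice.unpickle => [p|]; [have [] := vP p|rewrite normr0].
move=> x y Cx Cy xy.
have := hX; rewrite open_hausdorff => /(_ x y (introN eqP xy))[[P Q]] /=.
move=> [/set_mem Px /set_mem Qy] [Po Qo /eqP PQ].
have [W [Wo Wx WP]] := open_shrink Po Px.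
have [Z [Zo Zy ZQ]] := open_shrink Qo Qy.
have [_ [[i _ <-] gix giW]] := gC x W Cx Wo Wx.
have [_ [[j _ <-] gjy gjZ]] := gC y Z Cy Zo Zy.
have [_ _ []] := vP (i, j).
  apply/seteqP; split=> // z [/= iz jz]; suff: (P `&` Q) z by rewrite PQ.
  split.
    by apply: WP; exact: (closureS giW).
  by apply: ZQ; exact: (closureS gjZ).
move=> /(_ x (conj gix Cx)) fx /(_ y (conj gjy Cy)) fy.
exists (choice.pickle (i, j)); rewrite choice.pickleK fx fy.
by apply/eqP; rewrite eq_sym oner_eq0.
Qed.

Definition cozero_functions A (u : nat -> X -> R) :=
  [/\ (forall n, continuous (u n)), (forall n x, `|u n x| <= 1),
    (forall n x, u n x != 0 -> A x) & forall x, A x -> exists n, u n x != 0].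

(** Each member whose trace on [closure A] has its closure inside [A] gets a Urysohn function equal
    to 1 on that trace and 0 off [A]. By regularity these traces cover [A]. *)
Lemma countable_cozero_functions A g : open A ->
  (forall n : nat, open (g n)) -> outer_base (closure A) (range g) ->
  exists u, cozero_functions A u.
Proof.
move=> Ao go gA.
have /choice[u uP] : forall n, exists f : X -> R,
    [/\ continuous f, (forall x, `|f x| <= 1), (forall x, ~ A x -> f x = 0) &
      closure (g n `&` closure A) `<=` A -> forall x, (g n `&` closure A) x -> f x = 1].
  move=> n; have [nA|nA] := pselect (closure (g n `&` closure A) `<=` A).
    have AC : closed (~` A) by exact: open_closedC.
    have [|f [fc f0 f1 fb]] := urysohn_unit AC (@closed_closure _ (g n `&` closure A)).
      by apply/seteqP; split=> // z [/= nAz /nA].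
    by exists f; split=> // _ x gx; apply: f1; exact: subset_closure.
  by exists (fun=> 0); split=> // x; [exact: cvg_cst|rewrite normr0].
exists u; split=> [n|n x|n x|x Ax].
- by have [] := uP n.
- by have [] := uP n.
- by have [_ _ u0 _] := uP n; apply: contraNP => /u0 ->.
have [W [Wo Wx WA]] := open_shrink Ao Ax.
have cAx : closure A x by exact: subset_closure.
have [_ [[n _ <-] gx gW]] := gA x W cAx Wo Wx.
exists n; have [_ _ _ ->] := uP n; [exact: oner_neq0| |by []].
by apply: subset_trans WA; exact: closureS.
Qed.

Lemma metrizable_of_separating C (u : nat -> X -> R) : closed C ->
  (forall n, continuous (u n)) -> (forall n x, `|u n x| <= 1) ->
  (forall x y, C x -> C y -> x <> y -> exists n, u n x <> u n y) ->
  metrizable_subspace R C.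
Proof.
move=> cC uc u1 uC.
pose D x y := range (fun n => 2^-1 ^+ n * `|u n x - u n y|).
pose d x y := sup (D x y).
have w0 n : 0 < 2^-1 ^+ n :> R by rewrite exprn_gt0.
have le2 n x y : `|u n x - u n y| <= 2.
  by apply: (le_trans (ler_normB _ _)); have := u1 n x; have := u1 n y; lra.
have d_ge x y n : 2^-1 ^+ n * `|u n x - u n y| <= d x y.
  apply: ub_le_sup; last by exists n.
  exists 2 => _ [m _ <-]; apply: le_trans (le2 m x y).
  by rewrite ler_piMl// exprn_ile1// invf_le1// ler1n.
have d_le x y e : (forall n, 2^-1 ^+ n * `|u n x - u n y| <= e) -> d x y <= e.
  move=> De; apply: ge_sup; last by move=> _ [n _ <-].
  by exists (2^-1 ^+ 0 * `|u 0%N x - u 0%N y|), 0%N.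
have d_near x e : 0 < e -> nbhs x [set y | d x y < e].
  move=> e0; have e2 : 0 < e / 2 by rewrite divr_gt0.
  have e4 : 0 < e / 2 / 2 by rewrite !divr_gt0.
  (* From index [N] on, the weight is at most [e / 4] and the difference at most 2; only the first
     [N] functions need continuity. *)
  have [N Ne] := geometric_small e4.
  have : nbhs x [set y | forall n, (n < N)%N -> `|u n x - u n y| <= e / 2].
    elim: (N) => [|m IH]; first by apply: filterE.
    have /cvgrPdist_le/(_ _ e2) um := uc m x.
    apply: filterS (filterI um IH) => y [/= ym yi] i.
    by rewrite ltnS leq_eqVlt => /predU1P[->|/yi].
  apply: filterS => y yN; apply: (@le_lt_trans _ _ (e / 2)); last by lra.
  apply: d_le => n; have [nN|Nn] := ltnP n N.
    by apply: le_trans (yN n nN); rewrite ler_piMl// exprn_ile1// invf_le1// ler1n.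
  apply: (@le_trans _ _ (e / 2 / 2 * 2)); last by rewrite divfK.
  apply: ler_pM => //.
  by apply: le_trans Ne; rewrite ler_wiXn2l// invf_le1// ler1n.
exists d; split.
- move=> x y Cx Cy; split=> [d0|->].
    apply: contrapT => /(uC x y Cx Cy)[n] /eqP; rewrite -subr_eq0 -normr_gt0 => un.
    by have := d_ge x y n; rewrite d0 leNgt mulr_gt0.
  apply/eqP; rewrite eq_le (le_trans _ (d_ge y y 0%N)) ?mulr_ge0 ?exprn_ge0// andbT.
  by apply: d_le => n; rewrite subrr normr0 mulr0.
- move=> x y _ _; congr sup; apply/funext => r; apply/propext.
  by split=> -[n _ <-]; exists n => //; rewrite distrC.
- move=> x y z _ _ _; apply: d_le => n.
  rewrite -(subrKA (u n y)).
  apply: (@le_trans _ _ (2^-1 ^+ n * (`|u n x - u n y| + `|u n y - u n z|))).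
    by rewrite ler_wpM2l ?ler_normD// ltW.
  by rewrite mulrDr lerD.
move=> A AC; split=> [[V [Vo AV]] x|Aball].
  rewrite AV => -[Vx Cx].
  have cD : compact (C `\` V).
    apply: (subclosed_compact _ cX) => //; rewrite setDE.
    by apply: closedI => //; exact: open_closedC.
  (* These sets cover the compact set [C] minus [V]; a finite subcover bounds the distance from [x]
     to it away from 0. *)
  pose Q (p : nat * nat) := [set y | p.2.+1%:R^-1 < 2^-1 ^+ p.1 * `|u p.1 x - u p.1 y|].
  have Qo p : open (Q p).
    have : continuous (fun y => 2^-1 ^+ p.1 * `|u p.1 x - u p.1 y|).
      move=> y; apply: cvgM; first exact: cvg_cst.
      by apply: cvg_norm; apply: cvgB; [exact: cvg_cst|exact: uc].
    by move=> /continuousP/(_ _ (@open_gt R p.2.+1%:R^-1)).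
  have [|D' _ DQ] := @compact_finite_subcover X _ _ setT Q cD (fun p _ => Qo p).
    move=> y [Cy nVy]; have [|n /eqP] := uC x y Cx Cy.
      by move=> xy; apply: nVy; rewrite -xy.
    rewrite -subr_eq0 -normr_gt0 => /(mulr_gt0 (w0 n))/ltr_add_invr[k].
    by rewrite add0r => nk; exists (n, k).
  exists (\max_(p <- finmap.enum_fset D') p.2).+1%:R^-1; first by rewrite invr_gt0.
  move=> y [Cy dxy]; split=> //; apply: contrapT => nVy.
  have [p pD pQ] := DQ y (conj Cy nVy).
  have pN : (p.2 <= \max_(p <- finmap.enum_fset D') p.2)%N by exact: leq_bigmax_seq.
  have := lt_trans pQ (le_lt_trans (d_ge x y p.1) dxy).
  by rewrite ltf_pV2 ?posrE// ltr_nat ltnS ltnNge pN.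
(* Since [d] is defined on all of [X] and its balls are neighbourhoods of their centres there, their
   interiors in [X] assemble the ambient open set. *)
exists (\bigcup_(p in [set p : X * R |
    A p.1 /\ 0 < p.2 /\ [set y | C y /\ d p.1 y < p.2] `<=` A])
  [set y | d p.1 y < p.2]°); split.
  by apply: bigcup_open => p _; exact: open_interior.
apply/seteqP; split=> [x Ax|x [[[z e] /= [Az [e0 sA]] /interior_subset xe] Cx]].
  split; last exact: AC.
  have [e e0 eA] := Aball x Ax; exists (x, e) => //=; exact: d_near.
by apply: sA; split.
Qed.

End CompactHausdorff.

(** * The two subspaces *)

Section BasePieces.
Variables (R : realType) (X : topologicalType).
Hypothesis cX : compact [set: X].
Hypothesis hX : hausdorff_space X.
Implicit Types (A C S V O : set X) (B : nat -> set (set X)).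

Definition extended_base S B : set (set X) := [set extend S A | A in \bigcup_n B n].

Lemma base_sub_extend S B A : is_subspace_base S (\bigcup_n B n) ->
  (\bigcup_n B n) A -> A `<=` extend S A.
Proof. by move=> [Bo _] /Bo[V [Vo ->]]; exact: (sub_extend Vo). Qed.

Lemma extended_base_open S B E : extended_base S B E -> open E.
Proof. by move=> [A _ <-]; exact: extend_open. Qed.

(** Shrinking [V] first leaves room for the growth of [A] to [closure A]. *)
Lemma extended_base_outer S B x V : is_subspace_base S (\bigcup_n B n) ->
  S x -> open V -> V x ->
  exists E, [/\ extended_base S B E, E x & E `&` closure S `<=` V].
Proof.
move=> SB Sx Vo Vx; have [W [Wo Wx WV]] := open_shrink cX hX Vo Vx.
have [A [BA Ax AW]] := SB.2 x W Sx Wo Wx.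
exists (extend S A); split; [by exists A|exact: (base_sub_extend SB BA)|].
by apply: subset_trans WV => y /extend_cap_closure; exact: closureS.
Qed.

Lemma extended_base_countable S B x :
  (forall n, strongly_point_finite S (B n)) -> closure S x ->
  countable [set E | extended_base S B E /\ E x].
Proof.
move=> BS Sx.
have : countable (\bigcup_n [set extend S A | A in [set A | B n A /\ extend S A x]]).
  apply: bigcup_countable => // n _; apply: finite_set_countable.
  by apply: finite_image; exact: strongly_point_finite_extend.
apply: sub_countable; apply: subset_card_le.
by move=> _ [[A [n _ BA] <-] Ex]; exists n => //; exists A.
Qed.

Definition pieces O B n := [set A | B n A /\ closure A `<=` O].

(** Inside the open set [O], which lies in [S], relatively open and open mean the same. *)
Lemma pieces_open S O B n A : is_subspace_base S (\bigcup_n B n) ->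
  open O -> O `<=` S -> pieces O B n A -> open A.
Proof.
move=> [Bo _] Oo OS [BA AO]; have [|V [Vo AV]] := Bo A; first by exists n.
suff -> : A = V `&` O by exact: openI.
apply/seteqP; split=> [x Ax|x [Vx Ox]].
  by split; [move: Ax; rewrite AV => -[]|apply: AO; exact: subset_closure].
by rewrite AV; split=> //; exact: OS.
Qed.

(** The closure of a piece stays inside [S], where the extended base is both point-countable and an
    outer base; Mishchenko's lemma then applies to that closure. *)
Lemma pieces_functions S O B : (forall n, strongly_point_finite S (B n)) ->
  is_subspace_base S (\bigcup_n B n) -> open O -> O `<=` S ->
  exists u : set X -> nat -> X -> R,
    forall n A, pieces O B n A -> cozero_functions A (u A).
Proof.
move=> BS SB Oo OS.
have /choice[u uP] : forall A, exists v : nat -> X -> R,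
    (exists n, pieces O B n A) -> cozero_functions A v.
  move=> A; have [[n nA]|nA] := pselect (exists n, pieces O B n A); last first.
    by exists (fun _ _ => 0).
  have AS : closure A `<=` S by apply: subset_trans OS; exact: nA.2.
  have cA : compact (closure A).
    by apply: (subclosed_compact _ cX) => //; exact: closed_closure.
  have [|x Ax|x V Ax Vo Vx|g [go gA]] :=
    @countable_outer_base X (closure A) (extended_base S B) hX cA.
  - exact: extended_base_open.
  - by apply: extended_base_countable => //; apply: subset_closure; exact: AS.
  - have [E [BE Ex EV]] := extended_base_outer SB (AS x Ax) Vo Vx.
    exists E; split=> // y [Ey Ay]; apply: EV; split=> //.
    by apply: subset_closure; exact: AS.
  have [v vA] :=
    countable_cozero_functions R cX hX (pieces_open SB Oo OS nA) go gA.
  by exists v.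
by exists u => n A nA; apply: uP; exists n.
Qed.

Lemma pieces_separate S O B x y : is_subspace_base S (\bigcup_n B n) ->
  open O -> O `<=` S -> O x -> x <> y ->
  exists n A, [/\ pieces O B n A, A x & ~ A y].
Proof.
move=> SB Oo OS Ox xy.
have Vo : open (O `&` ~` [set y]).
  apply: openI => //; apply: closed_openC; apply: accessible_closed_set1.
  exact: hausdorff_accessible.
have [W [Wo Wx WO]] := open_shrink cX hX Vo (conj Ox xy).
have [A [[n _ BA] Ax AW]] := SB.2 x W (OS x Ox) Wo Wx.
have AO : closure A `<=` O `&` ~` [set y] by apply: subset_trans WO; exact: closureS.
exists n, A; split=> //; first by split=> // z /AO[].
by move=> Ay; have [_] := AO y (subset_closure Ay); apply.
Qed.

Lemma piece_functions_finite S O B (u : set X -> nat -> X -> R) n m x :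
  (forall n, strongly_point_finite S (B n)) ->
  is_subspace_base S (\bigcup_n B n) ->
  (forall n A, pieces O B n A -> forall m x, u A m x != 0 -> A x) ->
  finite_set [set f | [set u A m | A in pieces O B n] f /\ f x != 0].
Proof.
move=> BS SB uA; have [Sx|nSx] := pselect (S x).
  have := strongly_point_finite_extend (BS n) (subset_closure Sx).
  move=> /(finite_image (fun A => u A m)); apply: sub_finite_set.
  move=> _ [[A nA <-] uAx]; exists A => //; split; first exact: nA.1.
  apply: (base_sub_extend SB); first by exists n => //; exact: nA.1.
  exact: (uA n A nA m).
apply: sub_finite_set (finite_set0 _) => _ [[A nA <-] /(uA n A nA m) Ax].
have [|V [_ AV]] := SB.1 A; first by exists n => //; exact: nA.1.
by move: Ax; rewrite AV => -[].
Qed.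

(** For fixed [m] a function is determined by its piece, so [k + 1] distinct functions nonzero at
    [x] come from [k + 1] distinct members of [B n] through [x]. *)
Lemma piece_functions_bounded S O B (u : set X -> nat -> X -> R) n m :
  boundedly_point_finite S (B n) ->
  is_subspace_base S (\bigcup_n B n) ->
  (forall n A, pieces O B n A -> forall m x, u A m x != 0 -> A x) ->
  exists k, forall x (s : seq (X -> R)), uniq s ->
    (forall f, f \in s -> [set u A m | A in pieces O B n] f /\ f x != 0) ->
    (size s <= k)%N.
Proof.
move=> [k kB] SB uA; exists k => x s us sx; rewrite leqNgt; apply/negP => ks.
have /choice[a aP] : forall i, exists A, (i <= k)%N ->
    [/\ B n A, A x & u A m = nth (fun=> 0) s i].
  move=> i; have [ik|] := leqP i k; last by exists set0.
  have [[A nA uAs] fx] := sx _ (mem_nth (fun=> 0) (leq_ltn_trans ik ks)).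
  exists A => _; split=> //; first exact: nA.1.
  by apply: (uA n A nA m); rewrite uAs.
have ax i : (i <= k)%N -> a i x by move=> /aP[].
have Sx : S x.
  have [Ba0 a0x _] := aP 0%N (leq0n _).
  have [|V [_ AV]] := SB.1 (a 0%N); first by exists n.
  by move: a0x; rewrite AV => -[].
suff : set0 x by [].
rewrite -(kB a); first by split=> // i /= ik; exact: ax.
  by move=> i /aP[].
move=> i j ik jk aij; have [_ _ ui] := aP i ik; have [_ _ uj] := aP j jk.
apply/eqP; rewrite -(nth_uniq (fun=> 0) _ _ us); last 2 first.
- exact: leq_ltn_trans ik ks.
- exact: leq_ltn_trans jk ks.
by rewrite -ui -uj aij.
Qed.

(** Lying in both closures makes both extended families point-countable. Each point is in [S1] or
    [S2], and the family of that side is an outer base there. *)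
Lemma meet_closures_countable_base S1 S2 B1 B2 : S1 `|` S2 = setT ->
  (forall n, strongly_point_finite S1 (B1 n)) ->
  (forall n, strongly_point_finite S2 (B2 n)) ->
  is_subspace_base S1 (\bigcup_n B1 n) -> is_subspace_base S2 (\bigcup_n B2 n) ->
  exists g : nat -> set X, (forall n, open (g n)) /\
    outer_base (closure S1 `&` closure S2) (range g).
Proof.
move=> S12 BS1 BS2 SB1 SB2.
apply: (@countable_outer_base _ _ (extended_base S1 B1 `|` extended_base S2 B2)) => //.
- apply: (subclosed_compact _ cX) => //.
  by apply: closedI; exact: closed_closure.
- by move=> A [] /extended_base_open.
- move=> x [x1 x2].
  have : countable (\bigcup_(b in [set: bool]) if b then
      [set A | extended_base S1 B1 A /\ A x] else [set A | extended_base S2 B2 A /\ A x]).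
    by apply: bigcup_countable => // -[] _; exact: extended_base_countable.
  apply: sub_countable; apply: subset_card_le.
  by move=> A [[] BA Ax]; [exists true|exists false].
- move=> x V [x1 x2] Vo Vx; have : (S1 `|` S2) x by rewrite S12.
  move=> [Sx|Sx].
    have [E [BE Ex EV]] := extended_base_outer SB1 Sx Vo Vx.
    by exists E; split=> //; [left|move=> y [Ey [y1 _]]; apply: EV].
  have [E [BE Ex EV]] := extended_base_outer SB2 Sx Vo Vx.
  by exists E; split=> //; [right|move=> y [Ey [_ y2]]; apply: EV].
Qed.

Lemma closureC_sub S1 S2 : S1 `|` S2 = setT -> ~` closure S2 `<=` S1.
Proof.
move=> S12 x nx; have : (S1 `|` S2) x by rewrite S12.
by case=> // /subset_closure.
Qed.

End BasePieces.

(** * Gluing the two sides along the intersection of the closures *)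

Section Assembly.
Variables (R : realType) (X : topologicalType).
Hypothesis cX : compact [set: X].
Hypothesis hX : hausdorff_space X.
Variables (S1 S2 : set X) (B1 B2 : nat -> set (set X)).
Hypothesis S12 : S1 `|` S2 = setT.
Hypothesis BS1 : forall n, strongly_point_finite S1 (B1 n).
Hypothesis BS2 : forall n, strongly_point_finite S2 (B2 n).
Hypothesis SB1 : is_subspace_base S1 (\bigcup_n B1 n).
Hypothesis SB2 : is_subspace_base S2 (\bigcup_n B2 n).

Lemma closures_meet_metrizable : metrizable_subspace R (closure S1 `&` closure S2).
Proof.
have cK : closed (closure S1 `&` closure S2) by apply: closedI; exact: closed_closure.
have [g [go gK]] := meet_closures_countable_base cX hX S12 BS1 BS2 SB1 SB2.
have [u [uc u1 uK]] := countable_separating_functions R cX hX cK go gK.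
exact: (metrizable_of_separating cX cK uc u1 uK).
Qed.

(** A point outside the intersection of the closures lies in [O1] or [O2], where a piece separates
    it from any other point; two points of the intersection are separated by some [v n]. Boundedness
    is a conditional clause so that the same families serve both conclusions. *)
Lemma separating_families : exists U : nat -> set (X -> R),
  [/\ (forall n f, U n f -> continuous f),
    (forall n f x, U n f -> `|f x| <= 1),
    (forall x y, x <> y -> exists n f, U n f /\ f x <> f y),
    (forall n x, finite_set [set f | U n f /\ f x != 0]) &
    (forall n, boundedly_point_finite S1 (B1 n)) ->
    (forall n, boundedly_point_finite S2 (B2 n)) ->
    forall n, exists k, forall x (s : seq (X -> R)), uniq s ->
      (forall f, f \in s -> U n f /\ f x != 0) -> (size s <= k)%N].
Proof.
have cK : closed (closure S1 `&` closure S2) by apply: closedI; exact: closed_closure.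
have [g [go gK]] := meet_closures_countable_base cX hX S12 BS1 BS2 SB1 SB2.
have [v [vc v1 vK]] := countable_separating_functions R cX hX cK go gK.
pose O1 := ~` closure S2; pose O2 := ~` closure S1.
have O1o : open O1 by apply: closed_openC; exact: closed_closure.
have O2o : open O2 by apply: closed_openC; exact: closed_closure.
have O1S : O1 `<=` S1 by exact: closureC_sub.
have O2S : O2 `<=` S2 by apply: closureC_sub; rewrite setUC.
have [u1 u1P] := pieces_functions R cX hX BS1 SB1 O1o O1S.
have [u2 u2P] := pieces_functions R cX hX BS2 SB2 O2o O2S.
(* A pair consists of the number of a base family and the number of a cozero function, one summand
   for each side; the last summand makes each [v n] a family of its own. *)
pose J : countType := ((nat * nat + nat * nat) + nat)%type.
pose U (j : J) : set (X -> R) := match j with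
  | inl (inl p) => [set u1 A p.2 | A in pieces O1 B1 p.1]
  | inl (inr p) => [set u2 A p.2 | A in pieces O2 B2 p.1]
  | inr n => [set v n] end.
have u1A n A : pieces O1 B1 n A -> forall m x, u1 A m x != 0 -> A x by move=> /u1P[].
have u2A n A : pieces O2 B2 n A -> forall m x, u2 A m x != 0 -> A x by move=> /u2P[].
exists (fun n => if choice.unpickle n is Some j then U j else set0); split.
- move=> n f; case: choice.unpickle => // -[[[k m]|[k m]]|k] /=.
  + by move=> [A /u1P[]// uc _ _ _ <-].
  + by move=> [A /u2P[]// uc _ _ _ <-].
  + by move=> ->.
- move=> n f x; case: choice.unpickle => // -[[[k m]|[k m]]|k] /=.
  + by move=> [A /u1P[]// _ ub _ _ <-].
  + by move=> [A /u2P[]// _ ub _ _ <-].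
  + by move=> ->.
- have sep O S B (u : set X -> nat -> X -> R) x y :
      open O -> O `<=` S -> is_subspace_base S (\bigcup_n B n) ->
      (forall n A, pieces O B n A -> cozero_functions A (u A)) ->
      O x -> x <> y ->
      exists n m (f : X -> R), [set u A m | A in pieces O B n] f /\ f x <> f y.
    move=> Oo OS SB uP Ox xy.
    have [n [A [nA Ax nAy]]] := pieces_separate cX hX SB Oo OS Ox xy.
    have [_ _ uA /(_ x Ax)[m um]] := uP n A nA.
    exists n, m, (u A m); split; first by exists A.
    by move=> uxy; apply/nAy/(uA m); rewrite -uxy.
  have tag j x y : (exists f, U j f /\ f x <> f y) -> exists n f,
      (if choice.unpickle n is Some j then U j else set0) f /\ f x <> f y.
    by move=> [f Uf]; exists (choice.pickle j), f; rewrite choice.pickleK.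
  have out x y : ~ (closure S1 `&` closure S2) x -> x <> y -> exists n f,
      (if choice.unpickle n is Some j then U j else set0) f /\ f x <> f y.
    move=> /not_andP[nx|nx] xy.
      have [n [m Uf]] := sep _ _ _ _ x y O2o O2S SB2 u2P nx xy.
      exact: (tag (inl (inr (n, m)))).
    have [n [m Uf]] := sep _ _ _ _ x y O1o O1S SB1 u1P nx xy.
    exact: (tag (inl (inl (n, m)))).
  move=> x y xy; have [Kx|/out] := pselect ((closure S1 `&` closure S2) x); last exact.
  have [Ky|/out/(_ (nesym xy))[n [f [Uf fyx]]]] := pselect ((closure S1 `&` closure S2) y).
    have [n vn] := vK x y Kx Ky xy.
    by apply: (tag (inr n)); exists (v n).
  by exists n, f; split=> //; exact: nesym.
- move=> n x; case: choice.unpickle => [[[[k m]|[k m]]|k]|] /=.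
  + exact: piece_functions_finite.
  + exact: piece_functions_finite.
  + by apply: sub_finite_set (finite_set1 (v k)) => f [].
  + by apply: sub_finite_set (finite_set0 _) => f [].
- move=> BB1 BB2 n; case: choice.unpickle => [[[[k m]|[k m]]|k]|] /=.
  + exact: piece_functions_bounded.
  + exact: piece_functions_bounded.
  + exists 1%N => x s us sv; apply: (@uniq_leq_size _ s [:: v k]) => // f /sv[-> _].
    exact: mem_head.
  + by exists 0%N => x [|f s] // _ /(_ f (mem_head _ _))[].
Qed.

End Assembly.

Theorem theorem3p6 (R : realType) (X : topologicalType)
  (Xcomp : compact [set: X]) (Xhaus : hausdorff_space X)
  (X1 X2 : set X) (hcov : X1 `|` X2 = [set: X]) :
  (sigma_strongly_point_finite_base X1 ->
   sigma_strongly_point_finite_base X2 ->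
   metrizable_subspace R (closure X1 `&` closure X2) /\ eberlein_compact R X) /\
  (sigma_boundedly_point_finite_base X1 ->
   sigma_boundedly_point_finite_base X2 ->
   metrizable_subspace R (closure X1 `&` closure X2) /\
   uniform_eberlein_compact R X).
Proof.
split=> -[B1 [BS1 SB1]] [B2 [BS2 SB2]].
  split; first exact: closures_meet_metrizable hcov BS1 BS2 SB1 SB2.
  have [U [Uc U1 Usep Ufin _]] :=
    separating_families R Xcomp Xhaus hcov BS1 BS2 SB1 SB2.
  exact: eberlein_of_families Uc U1 Usep Ufin.
have BS1' n := boundedly_strongly_point_finite (BS1 n).
have BS2' n := boundedly_strongly_point_finite (BS2 n).
split; first exact: closures_meet_metrizable hcov BS1' BS2' SB1 SB2.
have [U [Uc U1 Usep _ /(_ BS1 BS2) Ubnd]] :=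
  separating_families R Xcomp Xhaus hcov BS1' BS2' SB1 SB2.
exact: uniform_eberlein_of_families Uc U1 Usep Ubnd.
Qed.
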